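(* Let $U$ be an open subset of a complex Banach space $E$ and let $v$ be a weight on $U$. Assume that the set $\mathbb{T}\,\mathrm{At}_{G^\infty_v(U)}=\{\lambda v(z)\delta_z : \lambda\in\mathbb{T},\ z\in U\}$ is a norm-closed set of uniformly strongly exposed points of the closed unit ball $B_{G^\infty_v(U)}$. Then $H^\infty_v(U,F)$ has the $WH^\infty$-BPB property for every complex Banach space $F$.
   Context: Notation: $B_X$, $S_X$ are the closed unit ball and unit sphere of a Banach space $X$; $\mathbb{T}$ is the unit circle of $\mathbb{C}$. A weight on $U$ is a strictly positive continuous function on $U$. $H^\infty_v(U,F)$ is the Banach space of holomorphic mappings $f:U\to F$ with $\|f\|_v:=\sup\{v(z)\|f(z)\|: z\in U\}<\infty$; $H^\infty_v(U):=H^\infty_v(U,\mathbb{C})$. $G^\infty_v(U)$ is the space of all linear functionals on $H^\infty_v(U)$ whose restriction to $B_{H^\infty_v(U)}$ is continuous for the compact-open topology; it is a closed subspace of $H^\infty_v(U)^*$, with the norm of $H^\infty_v(U)^*$. For $z\in U$, $\delta_z\in G^\infty_v(U)$ is the evaluation $\delta_z(f)=f(z)$. The atoms of $G^\infty_v(U)$ are the elements of $\mathrm{At}_{G^\infty_v(U)}=\{v(z)\delta_z: z\in U\}$. Uniformly strongly exposed points: for a complex Banach space $X$, $f\in S_{X^*}$ and $0<\delta<1$, put $S(B_X,f,\delta)=\{x\in B_X:\mathrm{Re}(f(x))>1-\delta\}$. A subset $S\subseteq S_X$ is a set of uniformly strongly exposed points of $B_X$ if there is a family $\{f_x: x\in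 S\}\subseteq S_{X^*}$ with $f_x(x)=1$ for every $x\in S$ such that, for every $0<\varepsilon<1$, there is $0<\delta<1$ with $\mathrm{diam}(S(B_X,f_x,\delta))<\varepsilon$ for all $x\in S$. $WH^\infty$-BPB property: $H^\infty_v(U,F)$ has the $WH^\infty$-BPB property if for every $0<\varepsilon<1$ there is $0<\eta(\varepsilon)<\varepsilon$ such that for every $f\in S_{H^\infty_v(U,F)}$, every $\lambda\in\mathbb{T}$ and every $z\in U$ with $v(z)\|f(z)\|>1-\eta(\varepsilon)$, there exist $f_0\in S_{H^\infty_v(U,F)}$, $\lambda_0\in\mathbb{T}$ and $z_0\in U$ such that $v(z_0)\|f_0(z_0)\|=1$, $\|f-f_0\|_v<\varepsilon$ and $\|\lambda v(z)\delta_z-\lambda_0v(z_0)\delta_{z_0}\|<\varepsilon$ (the last norm being that of $G^\infty_v(U)$). *)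

(* Defs.v *)
From HB Require Import structures.
From mathcomp Require Import all_boot all_order all_algebra.
From mathcomp Require Import complex.
From mathcomp Require Import all_classical all_reals all_analysis.

Set Implicit Arguments.
Unset Strict Implicit.
Unset Printing Implicit Defensive.
Import Order.TTheory GRing.Theory Num.Theory.
Import numFieldNormedType.Exports.
Local Open Scope classical_set_scope.
Local Open Scope ring_scope.
Local Open Scope complex_scope.

(* The norm of a normed space over R[i] takes its values in R[i] (where [<=]
   is the order of R on elements with equal imaginary parts); [rnorm] is the
   same norm with values in R, so that suprema can be taken. *)
Definition rnorm (R : realType) (X : normedModType R[i]) (x : X) : R :=
  complex.Re `|x|.

Section RealNorm.
Variables (R : realType) (X : normedModType R[i]).
Implicit Types x y : X.

Lemma rnormE x : (rnorm x)%:C = `|x|.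
Proof. by rewrite /rnorm RRe_real// normr_real. Qed.

Lemma rnorm_ge0 x : 0 <= rnorm x.
Proof. by rewrite -lecR rnormE normr_ge0. Qed.

Lemma rnorm0 : rnorm (0 : X) = 0.
Proof. by rewrite /rnorm normr0. Qed.

Lemma rnorm0_eq0 x : rnorm x = 0 -> x = 0.
Proof. by move=> x0; apply/eqP; rewrite -normr_eq0 -rnormE x0. Qed.

Lemma ler_rnormD x y : rnorm (x + y) <= rnorm x + rnorm y.
Proof. by rewrite -lecR rmorphD/= !rnormE ler_normD. Qed.

Lemma rnormZ (l : R[i]) x : rnorm (l *: x) = rnorm (l : R[i]^o) * rnorm x.
Proof. by apply: complexI; rewrite rmorphM/= !rnormE normrZ. Qed.

End RealNorm.

Definition unit_circle (R : realType) : set R[i] :=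
  [set lambda : R[i] | `|lambda| = 1].

Section UniformlyStronglyExposed.
Variables (R : realType) (X : normedModType R[i]).

Definition unit_ball : set X := [set x | rnorm x <= 1].
Definition unit_sphere : set X := [set x | rnorm x = 1].

Definition dual_norm (f : {linear X -> R[i]^o}) : R :=
  sup [set rnorm (f x) | x in unit_ball].

Definition dual_sphere : set {linear X -> R[i]^o} :=
  [set f : {linear X -> R[i]^o} | continuous f /\ dual_norm f = 1].

Definition slice (f : {linear X -> R[i]^o}) (delta : R) : set X :=
  [set x | unit_ball x /\ 1 - delta < complex.Re (f x)].

Definition diam (A : set X) : \bar R :=
  ereal_sup [set (rnorm (p.1 - p.2))%:E | p in A `*` A].

Definition unif_strongly_exposed (S : set X) : Prop :=
  S `<=` unit_sphere /\
  exists f : X -> {linear X -> R[i]^o},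
    (forall x, S x -> dual_sphere (f x) /\ f x x = 1) /\
    forall eps : R, 0 < eps < 1 ->
      exists2 delta : R, 0 < delta < 1 &
        forall x, S x -> (diam (slice (f x) delta) < eps%:E)%E.

End UniformlyStronglyExposed.

(* Complex Frechet differentiability at every point of U; the function on the
   subtype U is extended by 0, which is harmless when U is open. *)
Definition holomorphic (R : realType) (E F : normedModType R[i]) (U : set E)
    (f : U -> F) : Prop :=
  forall z : U, differentiable ('valL_0 f) (val z).

Record weight (R : realType) (E : normedModType R[i]) (U : set E) := Weight {
  weight_fun :> U -> R ;
  weight_continuous : continuous weight_fun ;
  weight_gt0 : forall z, 0 < weight_fun z }.

Section WeightedHolomorphic.
Variables (R : realType) (E : normedModType R[i]) (U : set E) (v : weight U).
Variable F : normedModType R[i].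

Definition Hv_pred : {pred U -> F} := mem [set f : U -> F |
  holomorphic f /\ has_ubound (range (fun z => v z * rnorm (f z)))].

Lemma Hv_submod : GRing.submod_closed Hv_pred.
Proof.
have v0 z : 0 <= v z by exact/ltW/weight_gt0.
split=> [|l f g].
  rewrite inE; split; last first.
    by exists 0 => _ [z _ <-]; rewrite /= rnorm0 mulr0.
  move=> z; rewrite (_ : 'valL_0 _ = cst 0) ?funeqE; first exact: differentiable_cst.
  by move=> x; rewrite /valL_ /=; case: ('oinv_ _ _).
rewrite !inE => -[fh [a fa]] [gh [b gb]]; split.
  move=> z.
  have -> : 'valL_0 (l *: f + g) = l *: 'valL_0 f + 'valL_0 g.
    apply/funext => x; rewrite /valL_ /= !fctE /=.
    by case: ('oinv_ _ _) => [y|]//=; rewrite scaler0 addr0.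
  apply: differentiableD; last exact: gh.
  apply: differentiableZ; exact: fh.
exists (rnorm (l : R[i]^o) * a + b) => _ [z _ <-].
apply: (@le_trans _ _
  (rnorm (l : R[i]^o) * (v z * rnorm (f z)) + v z * rnorm (g z))).
  by rewrite mulrCA -mulrDr ler_wpM2l// -rnormZ ler_rnormD.
apply: lerD; last by apply: gb; exists z.
by apply: ler_wpM2l; [exact: rnorm_ge0 | apply: fa; exists z].
Qed.

HB.instance Definition _ :=
  GRing.isSubmodClosed.Build R[i] (U -> F) Hv_pred Hv_submod.

Record Hv := MkHv { Hv_fun :> U -> F ; _ : Hv_fun \in Hv_pred }.

HB.instance Definition _ := [isSub for Hv_fun].
HB.instance Definition _ := [Choice of Hv by <:].
HB.instance Definition _ := [SubChoice_isSubLmodule of Hv by <:].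

Definition Hv_norm (f : Hv) : R := sup (range (fun z => v z * rnorm (f z))).

Lemma Hv_has_ubound (f : Hv) : has_ubound (range (fun z => v z * rnorm (f z))).
Proof. by case: f => f /= /set_mem[]. Qed.

Lemma Hv_norm_ub (f : Hv) z : v z * rnorm (f z) <= Hv_norm f.
Proof. by apply: ub_le_sup; [exact: Hv_has_ubound | exists z]. Qed.

Lemma Hv_norm_ge0 (f : Hv) : 0 <= Hv_norm f.
Proof.
have [[_ [z _ _]]|] := pselect (range (fun z => v z * rnorm (f z)) !=set0).
  apply: le_trans (Hv_norm_ub f z).
  by rewrite mulr_ge0 ?rnorm_ge0 ?ltW ?weight_gt0.
by move=> /set0P/negP/negPn/eqP f0; rewrite /Hv_norm f0 sup0.
Qed.

Lemma Hv_norm_le (f : Hv) (M : R) : 0 <= M ->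
  (forall z, v z * rnorm (f z) <= M) -> Hv_norm f <= M.
Proof.
move=> M0 fM.
have [ne|] := pselect (range (fun z => v z * rnorm (f z)) !=set0).
  by apply: ge_sup => // _ [z _ <-].
by move=> /set0P/negP/negPn/eqP f0; rewrite /Hv_norm f0 sup0.
Qed.

Let norm (f : Hv) : R[i] := (Hv_norm f)%:C.

Let ler_normD f g : norm (f + g) <= norm f + norm g.
Proof.
rewrite /norm -rmorphD/= lecR; apply: Hv_norm_le => [|z].
  by rewrite addr_ge0 ?Hv_norm_ge0.
apply: le_trans (lerD (Hv_norm_ub f z) (Hv_norm_ub g z)).
by rewrite -mulrDr ler_wpM2l ?ler_rnormD// ltW ?weight_gt0.
Qed.

Let normZ_le (l : R[i]) f : Hv_norm (l *: f) <= rnorm (l : R[i]^o) * Hv_norm f.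
Proof.
apply: Hv_norm_le => [|z]; first by rewrite mulr_ge0 ?rnorm_ge0 ?Hv_norm_ge0.
have -> : (l *: f) z = l *: f z by [].
by rewrite rnormZ mulrCA ler_wpM2l ?rnorm_ge0 ?Hv_norm_ub.
Qed.

Let normrZ (l : R[i]) f : norm (l *: f) = `|l| * norm f.
Proof.
rewrite -(rnormE (l : R[i]^o)) /norm -rmorphM/=; congr (_%:C).
apply/eqP; rewrite eq_le normZ_le/=.
have [->|l0] := eqVneq l 0; first by rewrite rnorm0 mul0r Hv_norm_ge0.
have /(ler_wpM2l (rnorm_ge0 (l : R[i]^o))) := normZ_le l^-1 (l *: f).
rewrite scalerA mulVf// scale1r => /le_trans; apply.
by rewrite mulrA -rnormZ /GRing.scale/= mulfV// /rnorm normr1 mul1r.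
Qed.

Let normr0_eq0 f : norm f = 0 -> f = 0.
Proof.
move=> /complexI f0; apply/val_inj/funext => z /=; apply: rnorm0_eq0.
have := Hv_norm_ub f z; rewrite f0 pmulr_rle0 ?weight_gt0// => f0'.
by apply/eqP; rewrite eq_le f0' rnorm_ge0.
Qed.

HB.instance Definition _ :=
  @Lmodule_isNormed.Build R[i] Hv norm ler_normD normrZ normr0_eq0.

Lemma rnorm_HvE (f : Hv) : rnorm f = Hv_norm f.
Proof. by []. Qed.

End WeightedHolomorphic.

Section WeightedPredual.
Variables (R : realType) (E : normedModType R[i]) (U : set E) (v : weight U).

Local Notation C := (R[i]^o).
Local Notation H := (Hv v C).

(* The compact-open topology on the space of weighted holomorphic functions,
   U carrying the topology induced by E. *)
Definition Hv_co := initial_topology (fun f : H => (f : {compact-open, U -> C})).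

Definition Gv_pred : {pred H -> C} := mem [set phi : H -> C |
  linear phi /\
  {within (@unit_ball R H : set Hv_co), continuous (phi : Hv_co -> C)}].

Lemma Gv_submod : GRing.submod_closed Gv_pred.
Proof.
split=> [|l phi psi].
  apply/mem_set; split; first by move=> a f g; rewrite scaler0 addr0.
  by move=> x; exact: cvg_cst.
move=> /set_mem[phil phic] /set_mem[psil psic]; apply/mem_set; split.
  move=> a f g; rewrite !fctE phil psil !scalerDr !scalerA (mulrC l a).
  by rewrite addrACA.
move=> x; apply: cvgD; last exact: psic.
by apply: cvgZr; exact: phic.
Qed.

HB.instance Definition _ :=
  GRing.isSubmodClosed.Build R[i] (H -> C) Gv_pred Gv_submod.

Record Gv := MkGv { Gv_fun :> H -> C ; _ : Gv_fun \in Gv_pred }.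

HB.instance Definition _ := [isSub for Gv_fun].
HB.instance Definition _ := [Choice of Gv by <:].
HB.instance Definition _ := [SubChoice_isSubLmodule of Gv by <:].

Definition Gv_norm (phi : Gv) : R :=
  sup [set rnorm (phi f) | f in @unit_ball R H].

Lemma Gv_linear (phi : Gv) : linear phi.
Proof. by case: phi => phi /= /set_mem[]. Qed.

Let Gv0 (phi : Gv) : phi 0 = 0.
Proof. by have := Gv_linear phi (-1) 0 0; rewrite !scaleN1r !addNr. Qed.

Let GvZ (phi : Gv) l f : phi (l *: f) = l *: phi f.
Proof. by have := Gv_linear phi l f 0; rewrite Gv0 !addr0. Qed.

Let ball0 : @unit_ball R H 0.
Proof. by rewrite /unit_ball/= rnorm0. Qed.

Lemma cvg_Hv_co0 (f : nat -> H) :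
  (forall n, unit_ball (f n)) ->
  (fun n => n.+1%:R^-1%:C *: f n) @ \oo --> (0 : Hv_co).
Proof.
move=> f1 P; rewrite nbhsE => -[_ [[W oW <-] W0] WP].
pose h := fun n => (n.+1%:R^-1%:C *: f n : H).
have : (fun n => (h n : {compact-open, U -> C})) @ \oo -->
       ((0 : H) : {compact-open, U -> C}).
  apply/(@compact_open_cvgP U C _ _ (fmap_filter _ _)) => K O' cK oO' KO'.
  have [[z0 Kz0]|K0] := pselect (K !=set0); last first.
    by exists 0%N => // n _ t [z Kz _]; case: K0; exists z.
  have O'0 : O' 0 by apply: KO'; exists z0.
  have /nbhs_ballP[e /= e0 eO'] : nbhs (0 : C) O' by exact: open_nbhs_nbhs.
  have : bounded_set ((fun z => (v z)^-1) @` K).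
    apply/compact_bounded/continuous_compact => //.
    apply: continuous_subspaceT => z.
    apply: continuousV; last exact: weight_continuous.
    by apply/eqP => v0; have := weight_gt0 v z; rewrite v0 ltxx.
  move=> /pinfty_ex_gt0[M M0 KM].
  have er : e = (complex.Re e)%:C by rewrite RRe_real ?gtr0_real.
  have e0' : 0 < complex.Re e by rewrite -ltcR -er.
  have eM : 0 < complex.Re e / M by rewrite divr_gt0.
  have := near_infty_natSinv_lt (PosNum eM); apply: filterS => n /= nM.
  move=> t [z Kz <-]; apply: eO'.
  rewrite -ball_normE/= sub0r normrN -(rnormE (h n z : C)) er ltcR.
  have -> : h n z = n.+1%:R^-1%:C *: f n z by [].
  rewrite rnormZ.
  have -> : rnorm (n.+1%:R^-1%:C : C) = n.+1%:R^-1.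
    by rewrite /rnorm ger0_norm//= lecR.
  apply: (@le_lt_trans _ _ (n.+1%:R^-1 * M)); last by rewrite -ltr_pdivlMr.
  apply: ler_wpM2l => //.
  have : v z * rnorm (f n z) <= 1.
    by apply: le_trans (f1 n); rewrite rnorm_HvE; exact: Hv_norm_ub.
  rewrite -ler_pdivlMl ?weight_gt0// mulr1 => /le_trans; apply.
  apply: le_trans (ler_norm _) _.
  by apply: KM; exists z.
move=> hW; have {}hW := hW W (open_nbhs_nbhs (conj oW W0)).
by case: hW => N _ hN; exists N => // n /hN; exact: WP.
Qed.

(* Continuity on the ball for the compact-open topology forces boundedness, so
   that [Gv] is indeed a subspace of the dual of [Hv v C]. *)
Lemma Gv_bounded (phi : Gv) :
  has_ubound [set rnorm (phi f) | f in @unit_ball R H].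
Proof.
have phic : {within (@unit_ball R H : set Hv_co),
    continuous (phi : Hv_co -> C)}.
  by case: phi => p /= /set_mem[].
apply: contrapT => nb.
have /choice[f fP] : forall n : nat, exists f : H,
    unit_ball f /\ n.+1%:R < rnorm (phi f).
  move=> n; apply: contrapT => /forallNP nf; apply: nb.
  exists n.+1%:R => _ [f f1 <-]; rewrite leNgt; apply/negP => lt.
  by apply: (nf f).
have f1 n : unit_ball (f n) by case: (fP n).
pose h n : H := n.+1%:R^-1%:C *: f n.
have hn n : rnorm (n.+1%:R^-1%:C : C) = n.+1%:R^-1.
  by rewrite /rnorm ger0_norm//= lecR.
have h1 n : unit_ball (h n).
  rewrite /unit_ball/= rnormZ hn -[leRHS]mulr1 ler_pM ?rnorm_ge0//.
    by rewrite invf_le1// ler1n.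
  exact: f1.
have : (phi \o h) @ \oo --> phi 0.
  move=> P phiP; have := phic 0 P phiP.
  rewrite /nbhs/= -nbhs_subspace_in// => /(cvg_Hv_co0 f1).
  by case=> N _ hN; exists N => // n /hN; apply; exact: h1.
rewrite Gv0 => /cvgrPdist_lt/(_ 1 ltr01)[N _ /(_ N (leqnn N))].
rewrite /= sub0r normrN -(rnormE (phi (h N) : C)) ltcR GvZ rnormZ hn.
rewrite -ltr_pdivlMl ?invr_gt0// invrK mulr1.
by rewrite ltNge ltW//; case: (fP N).
Qed.

Lemma Gv_norm_ub (phi : Gv) f : unit_ball f -> rnorm (phi f) <= Gv_norm phi.
Proof. by move=> f1; apply: ub_le_sup; [exact: Gv_bounded | exists f]. Qed.

Lemma Gv_norm_ge0 (phi : Gv) : 0 <= Gv_norm phi.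
Proof. by apply: le_trans (Gv_norm_ub phi ball0); exact: rnorm_ge0. Qed.

Lemma Gv_norm_le (phi : Gv) (M : R) :
  (forall f, unit_ball f -> rnorm (phi f) <= M) -> Gv_norm phi <= M.
Proof.
move=> phiM; apply: ge_sup => [|_ [f f1 <-]]; last exact: phiM.
by exists (rnorm (phi 0)), 0.
Qed.

Let norm (phi : Gv) : R[i] := (Gv_norm phi)%:C.

Let ler_normD phi psi : norm (phi + psi) <= norm phi + norm psi.
Proof.
rewrite /norm -rmorphD/= lecR; apply: Gv_norm_le => f f1.
apply: le_trans (lerD (Gv_norm_ub phi f1) (Gv_norm_ub psi f1)).
exact: ler_rnormD.
Qed.

Let normZ_le (l : R[i]) phi :
  Gv_norm (l *: phi) <= rnorm (l : C) * Gv_norm phi.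
Proof.
apply: Gv_norm_le => f f1; have -> : (l *: phi) f = l *: phi f by [].
by rewrite rnormZ ler_wpM2l ?rnorm_ge0 ?Gv_norm_ub.
Qed.

Let normrZ (l : R[i]) phi : norm (l *: phi) = `|l| * norm phi.
Proof.
rewrite -(rnormE (l : C)) /norm -rmorphM/=; congr (_%:C).
apply/eqP; rewrite eq_le normZ_le/=.
have [->|l0] := eqVneq l 0; first by rewrite rnorm0 mul0r Gv_norm_ge0.
have /(ler_wpM2l (rnorm_ge0 (l : C))) := normZ_le l^-1 (l *: phi).
rewrite scalerA mulVf// scale1r => /le_trans; apply.
by rewrite mulrA -rnormZ /GRing.scale/= mulfV// /rnorm normr1 mul1r.
Qed.

Let normr0_eq0 phi : norm phi = 0 -> phi = 0.
Proof.
move=> /complexI phi0; apply/val_inj/funext => f /=; apply: rnorm0_eq0.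
have [->|f0] := eqVneq f 0; first by rewrite Gv0 rnorm0.
have nf0 : 0 < rnorm f.
  rewrite lt_neqAle rnorm_ge0 andbT eq_sym; apply/eqP => /rnorm0_eq0.
  exact/eqP.
have nf : rnorm ((rnorm f)^-1%:C : C) = (rnorm f)^-1.
  by rewrite /rnorm ger0_norm//= lecR invr_ge0 ltW.
have := @Gv_norm_ub phi ((rnorm f)^-1%:C *: f).
rewrite /unit_ball/= rnormZ nf mulVf ?gt_eqF// => /(_ (lexx _)).
rewrite phi0 GvZ rnormZ nf pmulr_rle0 ?invr_gt0// => pf.
by apply/eqP; rewrite eq_le pf rnorm_ge0.
Qed.

HB.instance Definition _ :=
  @Lmodule_isNormed.Build R[i] Gv norm ler_normD normrZ normr0_eq0.

Lemma rnorm_GvE (phi : Gv) : rnorm phi = Gv_norm phi.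
Proof. by []. Qed.

Lemma evaluation_subproof (z : U) : (fun f : H => f z) \in Gv_pred.
Proof.
apply/mem_set; split => //.
apply: continuous_subspaceT.
have evalc : continuous (fun f : {compact-open, U -> C} => f z).
  apply/continuousP => W oW.
  rewrite (_ : _ @^-1` _ =
    [set g : {compact-open, U -> C} | g @` [set z] `<=` W]).
    by apply: compact_open_open => //; exact: compact_set1.
  by apply/seteqP; split => g /=; rewrite image_set1 sub1set inE.
move=> f; apply: (@continuous_comp Hv_co {compact-open, U -> C} C
  (fun g : H => (g : {compact-open, U -> C})) (fun g => g z)).
  exact: initial_continuous.
exact: evalc.
Qed.

Definition evaluation (z : U) : Gv := MkGv (evaluation_subproof z).

Definition atoms : set Gv := [set (v z)%:C *: evaluation z | z in [set: U]].

Definition circle_atoms : set Gv :=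
  [set lambda *: a | lambda in @unit_circle R & a in atoms].

End WeightedPredual.

Arguments atoms {R E U} v _.
Arguments circle_atoms {R E U} v _.

Definition WHinf_BPB (R : realType) (E : normedModType R[i]) (U : set E)
    (v : weight U) (F : normedModType R[i]) : Prop :=
  forall eps : R, 0 < eps < 1 ->
  exists2 eta : R, 0 < eta < eps &
  forall f : Hv v F, unit_sphere f ->
  forall lambda : R[i], unit_circle lambda ->
  forall z : U, 1 - eta < v z * rnorm (f z) ->
  exists (f0 : Hv v F) (lambda0 : R[i]) (z0 : U),
    [/\ unit_sphere f0, unit_circle lambda0,
        v z0 * rnorm (f0 z0) = 1,
        rnorm (f - f0) < eps &
        rnorm (lambda *: ((v z)%:C *: evaluation v z)
               - lambda0 *: ((v z0)%:C *: evaluation v z0)) < eps].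

(* Main.v *)
From HB Require Import structures.
Require Import Defs.
From mathcomp Require Import all_boot all_order all_algebra.
From mathcomp Require Import complex.
From mathcomp Require Import all_classical all_reals all_analysis.
From mathcomp Require Import ring lra.
Import Order.TTheory GRing.Theory Num.Theory.
Import numFieldNormedType.Exports.
Local Open Scope classical_set_scope.
Local Open Scope ring_scope.
Local Open Scope complex_scope.

Set Implicit Arguments.
Unset Strict Implicit.
Unset Printing Implicit Defensive.

(* This is Lindenstrauss's perturbation scheme.  Let f have norm one and almost attain its
   norm at z.  Correct f repeatedly by small multiples of rank-one operators phi_n (.) y_n
   composed with the evaluation map delta : U -> G_v, where phi_n exposes the current atom
   x_n and y_n is the value of the current mapping at x_n.  Almost norming points of the
   next mapping lie in a thin slice of phi_n, so uniform strong exposedness makes (x_n)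
   a Cauchy sequence; its limit is an atom because the set of atoms is closed, and the
   limit mapping attains its norm there.

   The corrections are holomorphic since delta is differentiable as a map into G_v.  For
   this it is enough to have a second-order Taylor bound, uniform on the unit ball of the
   scalar space, and that follows from Cauchy's estimate for functions that are merely
   complex differentiable at each point: Goursat's theorem on rectangles, applied to
   (g(t) - g(0)) / t^2 - g'(0) / t on squares around 0. *)

(** Each scalar [f] is differentiable only point by point, with no rate, so differentiability of
    delta in the norm of [Gv] needs a remainder bound common to the whole unit ball. The weight
    supplies it: near [z] it stays above [v z / 2], hence the unit ball is bounded there by
    [2 / v z], and a Cauchy estimate along complex lines depends only on this bound and the radius.
    The derivative must also belong to [Gv], that is, be compact-open continuous on the ball; it is
    a limit of difference quotients of evaluations, uniform on the ball. The mapping [f] is left as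
    it is and only the corrections accumulate, in one bounded operator [T] on [Gv]. The points of U
    met on the way need not converge; only their atoms do. Values of the mappings are therefore
    compared through atoms, by a Lipschitz estimate. Sizes: the n-th correction has norm at most
    [eps / 8 / 2 ^ n], the n-th atom moves by at most [eps / 16 / 2 ^ n]. The limit operator is
    bounded by [3 / 8 * eps], normalisation costs at most [(3 / 8 + 1 / 128) * eps], and together
    they stay below [eps]. *)

(** * Integrals of continuous functions over segments *)

Section SegmentIntegral.
Variable R : realType.
Implicit Types (a b c e K : R) (f g : R -> R).

Definition itg a b f : R :=
  \int[@lebesgue_measure R]_(x in `[a, b]) f x.

(** Two-sided continuity, also at the end points: this is what differentiability at the boundary
    points of a rectangle gives. *)
Definition cont_seg a b f :=
  forall x, a <= x <= b -> {for x, continuous f}.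

Lemma cont_seg_integrable a b f : cont_seg a b f ->
  (@lebesgue_measure R).-integrable `[a, b] (EFin \o f).
Proof.
move=> cf; apply: continuous_compact_integrable; first exact: segment_compact.
by apply: continuous_in_subspaceT => x /set_mem/=; rewrite in_itv/=; exact: cf.
Qed.

Lemma cont_segB a b f g : cont_seg a b f -> cont_seg a b g ->
  cont_seg a b (fun x => f x - g x).
Proof. by move=> cf cg x xab; apply: continuousB; [exact: cf|exact: cg]. Qed.

Lemma itg_cat a c b f : a <= c -> c <= b -> cont_seg a b f ->
  itg a b f = itg a c f + itg c b f.
Proof.
move=> ac cb cf; rewrite /itg.
have/= := @Rintegral_itvB R f (BLeft a) (BRight b) c (cont_seg_integrable cf).
rewrite !bnd_simp => /(_ ac cb) /eqP; rewrite subr_eq => /eqP ->.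
rewrite addrC; congr (_ + _); rewrite Rintegral_itv_obnd_cbnd//.
apply: integrableS (cont_seg_integrable cf) => //.
by apply: subset_itvr; rewrite bnd_simp.
Qed.

Lemma itgB a b f g : cont_seg a b f -> cont_seg a b g ->
  itg a b (fun x => f x - g x) = itg a b f - itg a b g.
Proof. by move=> cf cg; rewrite /itg RintegralB//; exact: cont_seg_integrable. Qed.

Lemma itg_cst a b K : a <= b -> itg a b (fun=> K) = K * (b - a).
Proof.
move=> ab; rewrite /itg Rintegral_cst//; congr (_ * _).
rewrite (_ : _ `[a, b]%classic = (b - a)%:E)//; have := lebesgue_measure_itv `[a, b].
rewrite /= lte_fin => ->.
by case: ltgtP ab => [||->]//=; rewrite subrr.
Qed.

Lemma itg_le a b f g : cont_seg a b f -> cont_seg a b g ->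
  (forall x, a <= x <= b -> f x <= g x) -> itg a b f <= itg a b g.
Proof.
move=> cf cg fg; apply: le_Rintegral => //; exact: cont_seg_integrable.
Qed.

Lemma cont_seg_cst a b K : cont_seg a b (fun=> K).
Proof. by move=> x _; exact: cvg_cst. Qed.

Lemma itg_near a b f K e : a <= b -> cont_seg a b f ->
  (forall x, a <= x <= b -> `|f x - K| <= e) ->
  `|itg a b f - K * (b - a)| <= e * (b - a).
Proof.
move=> ab cf fK; rewrite ler_distl -mulrBl -mulrDl -!itg_cst//.
by apply/andP; split; apply: itg_le => //; try exact: cont_seg_cst;
  move=> x /fK; rewrite ler_distl => /andP[].
Qed.

Lemma itg_ub a b f K : a <= b -> cont_seg a b f ->
  (forall x, a <= x <= b -> f x <= K) -> itg a b f <= K * (b - a).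
Proof. by move=> ab cf fK; rewrite -itg_cst//; apply: itg_le => //; exact: cont_seg_cst. Qed.

Lemma itg_lb a b f K : a <= b -> cont_seg a b f ->
  (forall x, a <= x <= b -> K <= f x) -> K * (b - a) <= itg a b f.
Proof. by move=> ab cf fK; rewrite -itg_cst//; apply: itg_le => //; exact: cont_seg_cst. Qed.

End SegmentIntegral.

(** * Closed 1-forms and their circulation around small rectangles *)

Section Goursat.
Variable R : realType.
Implicit Types (a b c d e l h x y A B D : R) (f g : R -> R) (P Q : R -> R -> R).

Definition diff_at P x0 y0 A B := forall e, 0 < e -> exists2 d, 0 < d &
  forall x y, `|x - x0| <= d -> `|y - y0| <= d ->
    `|P x y - P x0 y0 - A * (x - x0) - B * (y - y0)|
      <= e * (`|x - x0| + `|y - y0|).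

Lemma diff_at_swap P x0 y0 A B :
  diff_at P x0 y0 A B -> diff_at (fun y x => P x y) y0 x0 B A.
Proof.
move=> h e /h[d d0 hd]; exists d => // y x yd xd; have := hd x y xd yd.
by rewrite [in X in _ <= X -> _]addrC addrAC.
Qed.

Lemma diff_at_continuous P x0 y0 A B :
  diff_at P x0 y0 A B -> {for x0, continuous (P ^~ y0)}.
Proof.
move=> /(_ 1 ltr01)[d d0 hd]; apply/cvgrPdist_le => /= e e0.
have k0 : 0 < 1 + `|A| by rewrite ltr_pwDl.
have m0 : 0 < Num.min d (e / (1 + `|A|)) by rewrite lt_min d0 divr_gt0.
near=> x; rewrite distrC.
have : `|x - x0| <= Num.min d (e / (1 + `|A|)).
  by rewrite distrC; near: x; apply: cvgr_dist_le m0; exact: cvg_id.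
rewrite le_min => /andP[xd xe]; have := hd x y0 xd.
rewrite subrr normr0 (ltW d0) mulr0 addr0 subr0 mul1r => /(_ isT) H.
rewrite -[X in `|X|](subrK (A * (x - x0))); apply: le_trans (ler_normD _ _) _.
rewrite normrM; apply: (@le_trans _ _ ((1 + `|A|) * `|x - x0|)).
  by rewrite mulrDl mul1r lerD2r.
by rewrite mulrC -ler_pdivlMr.
Unshelve. all: by end_near. Qed.

(* The 1-form [P dx + Q dy] has real derivatives at the point, with [dP/dy = dQ/dx];
   no continuity of the derivatives is assumed. *)
Definition closed_at P Q x0 y0 :=
  exists A B D, diff_at P x0 y0 A B /\ diff_at Q x0 y0 B D.

Definition closed_on P Q a b c d := forall x y,
  a <= x <= b -> c <= y <= d -> closed_at P Q x y.

(* Counterclockwise integral of [P dx + Q dy] over the boundary of [a, b] x [c, d]. *)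
Definition circ P Q a b c d : R :=
  itg a b (P ^~ c) + itg c d (Q b) - itg a b (P ^~ d) - itg c d (Q a).

Lemma closed_at_contP P Q x y : closed_at P Q x y -> {for x, continuous (P ^~ y)}.
Proof. by move=> [A [B [D [h _]]]]; exact: diff_at_continuous h. Qed.

Lemma closed_at_contQ P Q x y : closed_at P Q x y -> {for y, continuous (Q x)}.
Proof.
by move=> [A [B [D [_ /diff_at_swap h]]]]; exact: diff_at_continuous h.
Qed.

Lemma circ_catx P Q a m b c d : a <= m -> m <= b ->
  cont_seg a b (P ^~ c) -> cont_seg a b (P ^~ d) ->
  circ P Q a b c d = circ P Q a m c d + circ P Q m b c d.
Proof. by move=> am mb Pc Pd; rewrite /circ (itg_cat am mb Pc) (itg_cat am mb Pd); ring. Qed.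

Lemma circ_caty P Q a b c m d : c <= m -> m <= d ->
  cont_seg c d (Q a) -> cont_seg c d (Q b) ->
  circ P Q a b c d = circ P Q a b c m + circ P Q a b m d.
Proof. by move=> am mb Pc Pd; rewrite /circ (itg_cat am mb Pc) (itg_cat am mb Pd); ring. Qed.

Lemma closed_onS P Q a b c d a' b' c' d' : a <= a' -> b' <= b -> c <= c' -> d' <= d ->
  closed_on P Q a b c d -> closed_on P Q a' b' c' d'.
Proof.
move=> aa bb cc dd H x y /andP[ax xb] /andP[cy yd].
by apply: H; [rewrite (le_trans aa)// (le_trans xb)|rewrite (le_trans cc)// (le_trans yd)].
Qed.

Lemma circ_small P Q x0 y0 e : closed_at P Q x0 y0 -> 0 < e -> exists2 d, 0 < d &
  forall a c l h, 0 <= l -> 0 <= h -> l + h <= d ->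
    a <= x0 <= a + l -> c <= y0 <= c + h ->
    closed_on P Q a (a + l) c (c + h) ->
    `|circ P Q a (a + l) c (c + h)| <= e * (l + h) ^+ 2.
Proof.
move=> [A [B [D [dP dQ]]]] e0; have e2 : 0 < e / 2 by rewrite divr_gt0.
have [d1 d10 hP] := dP _ e2; have [d2 d20 hQ] := dQ _ e2.
exists (Num.min d1 d2); first by rewrite lt_min d10.
move=> a c l h l0 h0; rewrite le_min => /andP[ld1 ld2] ax cy cl.
have al : a <= a + l by rewrite lerDl.
have ch : c <= c + h by rewrite lerDl.
have xd x : a <= x <= a + l -> `|x - x0| <= l.
  by move: ax => /andP[? ?] /andP[? ?]; rewrite ler_norml; apply/andP; split; lra.
have yd y : c <= y <= c + h -> `|y - y0| <= h.
  by move: cy => /andP[? ?] /andP[? ?]; rewrite ler_norml; apply/andP; split; lra.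
have eP x y : a <= x <= a + l -> c <= y <= c + h ->
    `|P x y - P x0 y0 - A * (x - x0) - B * (y - y0)| <= e / 2 * (l + h).
  move=> /xd xl /yd yh; apply: le_trans (hP x y _ _) _; try lra.
  by rewrite ler_pM2l// lerD.
have eQ x y : a <= x <= a + l -> c <= y <= c + h ->
    `|Q x y - Q x0 y0 - B * (x - x0) - D * (y - y0)| <= e / 2 * (l + h).
  move=> /xd xl /yd yh; apply: le_trans (hQ x y _ _) _; try lra.
  by rewrite ler_pM2l// lerD.
have cI : c <= c <= c + h by rewrite lexx.
have dI : c <= c + h <= c + h by rewrite lexx andbT.
have aI : a <= a <= a + l by rewrite lexx.
have bI : a <= a + l <= a + l by rewrite lexx andbT.
have cP y : c <= y <= c + h -> cont_seg a (a + l) (P ^~ y).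
  by move=> yI x xI; exact: closed_at_contP (cl _ _ xI yI).
have cQ x : a <= x <= a + l -> cont_seg c (c + h) (Q x).
  by move=> xI y yI; exact: closed_at_contQ (cl _ _ xI yI).
have HP : `|itg a (a + l) (fun x => P x c - P x (c + h)) - (- (B * h)) * (a + l - a)|
    <= e * (l + h) * (a + l - a).
  apply: itg_near => //; first by apply: cont_segB; exact: cP.
  move=> x xI; have := eP x _ xI cI; have := eP x _ xI dI.
  rewrite !ler_norml => /andP[? ?] /andP[? ?]; apply/andP; split; lra.
have HQ : `|itg c (c + h) (fun y => Q (a + l) y - Q a y) - (B * l) * (c + h - c)|
    <= e * (l + h) * (c + h - c).
  apply: itg_near => //; first by apply: cont_segB; exact: cQ.
  move=> y yI; have := eQ _ y aI yI; have := eQ _ y bI yI.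
  rewrite !ler_norml => /andP[? ?] /andP[? ?]; apply/andP; split; lra.
rewrite itgB in HP; [|exact: cP..]; rewrite itgB in HQ; [|exact: cQ..].
move: HP HQ; rewrite /circ !ler_norml => /andP[? ?] /andP[? ?].
apply/andP; split; nra.
Qed.

End Goursat.

(** * Goursat's theorem on rectangles, by bisection *)

Section Bisection.

(** Invariant and step relation may depend on the stage; this serves both the bisection and the
    iteration of perturbations. *)
Lemma dependent_choice_nat (T : Type) (P : nat -> T -> Prop)
    (Q : nat -> T -> T -> Prop) (s0 : T) :
  P 0%N s0 -> (forall n s, P n s -> exists s', P n.+1 s' /\ Q n s s') ->
  exists u : nat -> T, u 0%N = s0 /\ forall n, P n (u n) /\ Q n (u n) (u n.+1).
Proof.
move=> P0 PS.
have /choice[F FP] (ns : nat * T) : exists s', P ns.1 ns.2 ->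
    P ns.1.+1 s' /\ Q ns.1 ns.2 s'.
  have [/PS[s' hs']|nP] := pselect (P ns.1 ns.2); first by exists s'.
  by exists ns.2.
pose u := fix u n := if n is m.+1 then F (m, u m) else s0.
exists u; split=> // n.
have Pu : forall m, P m (u m) by elim=> //= m /(FP (m, u m))[].
by split=> //; have [] := FP (n, u n) (Pu n).
Qed.

Variable R : realType.
Implicit Types (a b c d e l h x y : R) (P Q : R -> R -> R).

Lemma expr2_gt0 n : 0 < 2 ^+ n :> R.
Proof. by rewrite exprn_gt0. Qed.

Lemma half_pow_le (K d : R) : 0 < d -> exists n, K / 2 ^+ n <= d.
Proof.
move=> d0; exists (Num.bound `|K / d|).
rewrite ler_pdivrMr ?expr2_gt0// mulrC -ler_pdivrMr//.
apply: le_trans (ler_norm _) _; apply/ltW/(lt_le_trans (archi_boundP _)) => //.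
rewrite -natrX ler_nat; apply: ltnW; exact: ltn_expl.
Qed.

(** Every left end lies below every right end, so the supremum of the left ends is in all the
    intervals. *)
Lemma nested_point (u : nat -> R) L : (forall n, u n <= u n.+1) ->
  (forall n, u n.+1 + L / 2 ^+ n.+1 <= u n + L / 2 ^+ n) -> 0 <= L ->
  exists x, forall n, u n <= x <= u n + L / 2 ^+ n.
Proof.
move=> u1 u2 L0.
have um m n : (m <= n)%N -> u m <= u n.
  by elim: n => [|n ih]; rewrite leq_eqVlt => /predU1P[->|]// /ih/le_trans; exact.
have un m n : (m <= n)%N -> u n + L / 2 ^+ n <= u m + L / 2 ^+ m.
  elim: n => [|n ih]; rewrite leq_eqVlt => /predU1P[->|]// /ih; apply: le_trans.
  exact: u2.
have ub m n : u n <= u m + L / 2 ^+ m.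
  have [/um h|/ltnW h] := leqP n m.
    by apply: le_trans h _; rewrite lerDl divr_ge0// ltW// expr2_gt0.
  by apply: le_trans (un _ _ h); rewrite lerDl divr_ge0// ltW// expr2_gt0.
exists (sup (range u)) => n; apply/andP; split.
  by apply: ub_le_sup; [exists (u 0%N + L / 2 ^+ 0) => _ [m _ <-]|exists n].
by apply: ge_sup => [|_ [m _ <-]//]; exists (u 0%N), 0%N.
Qed.

(** The inner sides cancel in the sum over the four quarters, so one quarter carries at least a
    fourth of the circulation. *)
Lemma circ_quarter P Q a c l h : 0 <= l -> 0 <= h ->
  closed_on P Q a (a + l) c (c + h) ->
  exists a' c', [/\ a' = a \/ a' = a + l / 2, c' = c \/ c' = c + h / 2 &
    `|circ P Q a (a + l) c (c + h)| <=
      4 * `|circ P Q a' (a' + l / 2) c' (c' + h / 2)| ].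
Proof.
move=> l0 h0 cl.
have cP y : c <= y <= c + h -> cont_seg a (a + l) (P ^~ y).
  by move=> yI x xI; exact: closed_at_contP (cl _ _ xI yI).
have cQ x : a <= x <= a + l -> cont_seg c (c + h) (Q x).
  by move=> xI y yI; exact: closed_at_contQ (cl _ _ xI yI).
have al : a + l = a + l / 2 + l / 2 by field.
have ch : c + h = c + h / 2 + h / 2 by field.
have aI : a <= a <= a + l by apply/andP; split; lra.
have mI : a <= a + l / 2 <= a + l by apply/andP; split; lra.
have bI : a <= a + l <= a + l by apply/andP; split; lra.
have cI : c <= c <= c + h by apply/andP; split; lra.
have nI : c <= c + h / 2 <= c + h by apply/andP; split; lra.
have dI : c <= c + h <= c + h by apply/andP; split; lra.
have [am mb] := andP mI; have [cn nd] := andP nI.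
have := @circ_catx _ P Q _ _ _ c (c + h) am mb (cP _ cI) (cP _ dI).
rewrite (circ_caty _ cn nd (cQ _ aI) (cQ _ mI)) (circ_caty _ cn nd (cQ _ mI) (cQ _ bI)).
set C := circ P Q a (a + l) c (c + h).
set C1 := circ P Q a (a + l / 2) c _; set C2 := circ P Q a (a + l / 2) _ _.
set C3 := circ P Q _ _ c _; set C4 := circ P Q _ _ _ _ => E.
have E3 : circ P Q (a + l / 2) (a + l / 2 + l / 2) c (c + h / 2) = C3 by rewrite -al.
have E2 : circ P Q a (a + l / 2) (c + h / 2) (c + h / 2 + h / 2) = C2 by rewrite -ch.
have E4 : circ P Q (a + l / 2) (a + l / 2 + l / 2) (c + h / 2) (c + h / 2 + h / 2) = C4.
  by rewrite -ch -al.
have [H|H1] := leP `|C| (4 * `|C1|); first by exists a, c; split=> //; left.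
have [H|H2] := leP `|C| (4 * `|C2|).
  by exists a, (c + h / 2); rewrite E2; split=> //; [left|right].
have [H|H3] := leP `|C| (4 * `|C3|).
  by exists (a + l / 2), c; rewrite E3; split=> //; [right|left].
exists (a + l / 2), (c + h / 2); rewrite E4; split; [by right|by right|].
have := ler_normD (C1 + C2) (C3 + C4); have := ler_normD C1 C2.
by have := ler_normD C3 C4; rewrite -E; lra.
Qed.

(** A circulation of modulus [D > 0] leaves at least [D / 4 ^ n] on some rectangle of the n-th
    bisection, whereas near the common point of these rectangles [circ_small] allows only
    [e * (L + H) ^+ 2 / 4 ^ n]. *)
Lemma goursat P Q a b c d : a <= b -> c <= d -> closed_on P Q a b c d ->
  circ P Q a b c d = 0.
Proof.
move=> ab cd cl; apply/eqP; rewrite -normr_eq0; apply/eqP/le_anti.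
rewrite normr_ge0 andbT leNgt; apply/negP.
set D := `|_| => D0; set L := b - a; set H := d - c.
have L0 : 0 <= L by rewrite subr_ge0.
have H0 : 0 <= H by rewrite subr_ge0.
pose rect n (s : R * R) := circ P Q s.1 (s.1 + L / 2 ^+ n) s.2 (s.2 + H / 2 ^+ n).
pose inv n (s : R * R) := [/\ a <= s.1, s.1 + L / 2 ^+ n <= b, c <= s.2,
  s.2 + H / 2 ^+ n <= d & D <= 4 ^+ n * `|rect n s|].
pose rel n (s s' : R * R) := [/\ s.1 <= s'.1, s.2 <= s'.2,
  s'.1 + L / 2 ^+ n.+1 <= s.1 + L / 2 ^+ n & s'.2 + H / 2 ^+ n.+1 <= s.2 + H / 2 ^+ n].
have clS n s : inv n s ->
    closed_on P Q s.1 (s.1 + L / 2 ^+ n) s.2 (s.2 + H / 2 ^+ n).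
  by move=> [i1 i2 i3 i4 _]; exact: closed_onS cl.
have [|n s inS|u [_ uP]] := @dependent_choice_nat _ inv rel (a, c).
- by rewrite /inv /rect /= !expr0 !divr1 !mul1r /L /H !subrKC.
- have l0 : 0 <= L / 2 ^+ n by rewrite divr_ge0// ltW// expr2_gt0.
  have h0 : 0 <= H / 2 ^+ n by rewrite divr_ge0// ltW// expr2_gt0.
  have [a' [c' [Ha Hc Hcirc]]] := circ_quarter l0 h0 (clS _ _ inS).
  have [i1 i2 i3 i4 i5] := inS.
  have [a1 a2] : s.1 <= a' /\ a' + L / 2 ^+ n / 2 <= s.1 + L / 2 ^+ n.
    by case: Ha => ->; move: (L / _) l0 => z z0; split; lra.
  have [c1 c2] : s.2 <= c' /\ c' + H / 2 ^+ n / 2 <= s.2 + H / 2 ^+ n.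
    by case: Hc => ->; move: (H / _) h0 => z z0; split; lra.
  exists (a', c'); rewrite /inv /rel /rect /=.
  have -> : L / 2 ^+ n.+1 = L / 2 ^+ n / 2 by rewrite exprSr invfM mulrA.
  have -> : H / 2 ^+ n.+1 = H / 2 ^+ n / 2 by rewrite exprSr invfM mulrA.
  split=> //; split.
  + exact: le_trans a1.
  + exact: le_trans a2 _.
  + exact: le_trans c1.
  + exact: le_trans c2 _.
  + by apply: le_trans i5 _; rewrite exprSr -mulrA ler_pM2l// exprn_gt0.
have [x xP] : exists x, forall n, (u n).1 <= x <= (u n).1 + L / 2 ^+ n.
  by apply: nested_point => // n; have [_ []] := uP n.
have [y yP] : exists y, forall n, (u n).2 <= y <= (u n).2 + H / 2 ^+ n.
  by apply: nested_point => // n; have [_ []] := uP n.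
have clxy : closed_at P Q x y.
  have [[/= i1 i2 i3 i4 _] _] := uP 0%N.
  have /andP[x1 x2] := xP 0%N; have /andP[y1 y2] := yP 0%N.
  apply: cl; first by rewrite (le_trans i1)// (le_trans x2).
  by rewrite (le_trans i3)// (le_trans y2).
(* This error turns the final comparison into [D <= D / 2 * (L + H) ^+ 2 / ((L + H) ^+ 2 + 1)],
   which is absurd; the [+ 1] covers a degenerate rectangle. *)
have e0 : 0 < D / (2 * ((L + H) ^+ 2 + 1)).
  by rewrite divr_gt0// mulr_gt0// ltr_wpDl// sqr_ge0.
have [dl dl0 small] := circ_small clxy e0.
have [n nP] := half_pow_le (L + H) dl0.
have [inS _] := uP n; have [_ _ _ _ i5] := inS.
have l0 : 0 <= L / 2 ^+ n by rewrite divr_ge0// ltW// expr2_gt0.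
have h0 : 0 <= H / 2 ^+ n by rewrite divr_ge0// ltW// expr2_gt0.
have sm : L / 2 ^+ n + H / 2 ^+ n <= dl by rewrite -mulrDl.
have := @small _ _ _ _ l0 h0 sm (xP n) (yP n) (clS _ _ inS); rewrite -mulrDl.
rewrite expr_div_n -exprM mulnC exprM (_ : 2 ^+ 2 = 4 :> R); last by ring.
move=> le; have p4 : 0 < 4 ^+ n :> R by rewrite exprn_gt0.
have : D <= D / (2 * ((L + H) ^+ 2 + 1)) * (L + H) ^+ 2.
  apply: le_trans i5 _; rewrite mulrC -ler_pdivlMr//; move: le; rewrite mulrA; exact.
rewrite mulrAC ler_pdivlMr ?mulr_gt0 ?ltr_wpDl ?sqr_ge0//.
by rewrite ler_pM2l//; have := sqr_ge0 (L + H); lra.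
Qed.

End Bisection.

(** * Complex derivatives, and circulation around concentric squares *)

Section Cauchy.
Variable R : realType.
Implicit Types (r s d e M x y : R) (t z : R[i]) (g k : R[i]^o -> R[i]^o).

(** The argument is typed in [R[i]] rather than [R[i]^o], so that it combines with the field
    operations. *)
Definition cabs z : R := rnorm (z : R[i]^o).

Lemma cabsE z : (cabs z)%:C = `|z|. Proof. exact: (rnormE (z : R[i]^o)). Qed.

Lemma cabs_ge0 z : 0 <= cabs z. Proof. exact: rnorm_ge0. Qed.

Lemma cabsM t z : cabs (t * z) = cabs t * cabs z.
Proof. by apply: complexI; rewrite rmorphM/= !cabsE normrM. Qed.

Lemma cabsV z : cabs z^-1 = (cabs z)^-1.
Proof. by apply: complexI; rewrite fmorphV/= !cabsE normfV. Qed.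

Lemma cabs_real x : cabs x%:C = `|x|.
Proof.
by rewrite /cabs /rnorm normc_def/= expr0n addr0 sqrtr_sqr.
Qed.

Lemma cabsD t z : cabs (t + z) <= cabs t + cabs z.
Proof. exact: ler_rnormD. Qed.

Lemma cabsN z : cabs (- z) = cabs z.
Proof. by rewrite /cabs /rnorm normrN. Qed.

Lemma cabs_sqr x y : cabs (x +i* y) ^+ 2 = x ^+ 2 + y ^+ 2.
Proof.
by rewrite /cabs /rnorm normc_def/= sqr_sqrtr// addr_ge0// sqr_ge0.
Qed.

Lemma Re_le_cabs z : `|complex.Re z| <= cabs z.
Proof.
case: z => x y; rewrite -ler_sqr ?nnegrE ?cabs_ge0// cabs_sqr real_normK ?num_real//.
by rewrite lerDl sqr_ge0.
Qed.

Lemma Im_le_cabs z : `|complex.Im z| <= cabs z.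
Proof.
case: z => x y; rewrite -ler_sqr ?nnegrE ?cabs_ge0// cabs_sqr real_normK ?num_real//.
by rewrite lerDr sqr_ge0.
Qed.

Lemma cabs_le_ReIm z : cabs z <= `|complex.Re z| + `|complex.Im z|.
Proof.
case: z => x y; rewrite -ler_sqr ?nnegrE ?addr_ge0 ?cabs_ge0// cabs_sqr/= sqrrD.
by rewrite !real_normK ?num_real// addrAC lerDl mulrn_wge0// mulr_ge0.
Qed.

Definition cderiv_at g z (d : R[i]) := forall e, 0 < e -> exists2 del, 0 < del &
  forall t, cabs (t - z) <= del ->
    cabs (g t - g z - d * (t - z)) <= e * cabs (t - z).

Lemma is_derive_cderiv_at g z (d : R[i]) :
  is_derive (z : R[i]^o) (1 : R[i]^o) g d -> cderiv_at g z d.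
Proof.
move=> [dg gd] e e0.
have eC : 0 < e%:C :> R[i] by rewrite ltcR.
have /cvgrPdist_le/(_ _ eC) := dg; rewrite -[lim _]/('D_1 g z) gd.
rewrite /at_right nearE => /nbhs_ballP[/= del del0 H].
have delE : del = (complex.Re del)%:C by rewrite RRe_real// gtr0_real.
have delr0 : 0 < complex.Re del by rewrite -ltcR -delE.
exists (complex.Re del / 2); first by rewrite divr_gt0.
move=> t tz; have [->|tz0] := eqVneq t z.
  by rewrite !subrr mulr0 subr0 /cabs rnorm0 mulr0.
have tz0' : t - z != 0 by rewrite subr_eq0.
have := H (t - z) _ tz0'; rewrite /ball/= sub0r normrN -(cabsE (t - z)).
rewrite delE ltcR => /(_ (le_lt_trans tz _)).
rewrite gtr_pMr ?invf_lt1 ?ltr1n// => /(_ isT).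
rewrite [X in g X](_ : _ = t); last by rewrite /= [(t - z) *: 1]mulr1 subrK.
rewrite -(cabsE (_ - _)) lecR => le.
have -> : g t - g z - d * (t - z) = - ((d - (t - z)^-1 * (g t - g z)) * (t - z)).
  by move: (g t : R[i]) (g z : R[i]) => a b; field.
by rewrite cabsN cabsM ler_wpM2r ?cabs_ge0.
Qed.

(* [Im (k dz)] is the 1-form [Im k dx + Re k dy]; its closedness is one of the
   Cauchy-Riemann equations. *)
Lemma cderiv_closed_at k x y (d : R[i]) : cderiv_at k (x +i* y) d ->
  closed_at (fun x y => complex.Im (k (x +i* y))) (fun x y => complex.Re (k (x +i* y))) x y.
Proof.
(* For [d = p + i q], the imaginary part of [d dz] is [q dx + p dy] and the real part is
   [p dx - q dy]. *)
case: d => p q h; exists q, p, (- q).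
have H e : 0 < e -> exists2 del, 0 < del & forall x' y', `|x' - x| <= del -> `|y' - y| <= del ->
    cabs (k (x' +i* y') - k (x +i* y) - (p +i* q) * ((x' - x) +i* (y' - y)))
      <= e * (`|x' - x| + `|y' - y|).
  move=> e0; have [del d0 hd] := h e e0; exists (del / 2); first by rewrite divr_gt0.
  move=> x' y' hx hy; have := cabs_le_ReIm ((x' - x) +i* (y' - y)); rewrite /= => le.
  have := hd (x' +i* y'); have -> : (x' +i* y') - (x +i* y) = (x' - x) +i* (y' - y) by [].
  move=> /(_ _)/le_trans; apply; last by rewrite ler_pM2l.
  by apply: le_trans le _; lra.
split=> e e0; have [del d0 hd] := H e e0; exists del => // x' y' hx hy;
  apply: le_trans (hd _ _ hx hy).
- apply: le_trans (Im_le_cabs _); rewrite le_eqVlt; apply/orP; left; apply/eqP.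
  by congr `|_|; case: (k _) => a b; case: (k _) => a' b' /=; ring.
- apply: le_trans (Re_le_cabs _); rewrite le_eqVlt; apply/orP; left; apply/eqP.
  by congr `|_|; case: (k _) => a b; case: (k _) => a' b' /=; ring.
Qed.

(** The frame between the squares splits into two full-height strips on the left and right and two
    blocks below and above the inner square. None meets the open inner square, so [goursat] removes
    all four. *)
Lemma circ_annulus (P Q : R -> R -> R) s r : 0 < s -> s <= r ->
  (forall x y, `|x| <= r -> `|y| <= r -> s <= `|x| \/ s <= `|y| -> closed_at P Q x y) ->
  circ P Q (- r) r (- r) r = circ P Q (- s) s (- s) s.
Proof.
move=> s0 sr cl.
have cl' x y : - r <= x <= r -> - r <= y <= r ->
    [\/ x <= - s, s <= x, y <= - s | s <= y] -> closed_at P Q x y.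
  move=> xr yr H; apply: cl; rewrite ?ler_norml//.
  by case: H => h; [left|left|right|right]; rewrite ler_normr 1?(lerNr s) ?h ?orbT.
have rr : - r <= r by lra.
have rs : - r <= - s by rewrite lerN2.
have ss : - s <= s by lra.
have nsr : - s <= r by lra.
have nrs : - r <= s by lra.
have cP a b y : - r <= a -> b <= r -> - r <= y <= r -> y <= - s \/ s <= y ->
    cont_seg a b (P ^~ y).
  move=> ra br yr h x /andP[ax xb]; apply: (closed_at_contP (Q := Q)).
  apply: cl' => //; last by case: h => h; [constructor 3|constructor 4].
  by rewrite (le_trans ra)// (le_trans xb).
have cQ a b x : - r <= a -> b <= r -> - r <= x <= r -> x <= - s \/ s <= x ->
    cont_seg a b (Q x).
  move=> ra br yr h y /andP[ax xb]; apply: (closed_at_contQ (P := P)).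
  apply: cl' => //; last by case: h => h; [constructor 1|constructor 2].
  by rewrite (le_trans ra)// (le_trans xb).
have rI : - r <= r <= r by apply/andP; split; lra.
have nrI : - r <= - r <= r by apply/andP; split; lra.
have sI : - r <= s <= r by apply/andP; split; lra.
have nsI : - r <= - s <= r by apply/andP; split; lra.
rewrite (@circ_catx _ P Q (- r) (- s) r (- r) r)//; last 2 first.
- by apply: cP => //; left.
- by apply: cP => //; right.
rewrite (@circ_catx _ P Q (- s) s r (- r) r)//; last 2 first.
- by apply: cP => //; left.
- by apply: cP => //; right.
rewrite (@circ_caty _ P Q (- s) s (- r) (- s) r)//; last 2 first.
- by apply: cQ => //; left.
- by apply: cQ => //; right.
rewrite (@circ_caty _ P Q (- s) s (- s) s r)//; last 2 first.
- by apply: cQ => //; left.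
- by apply: cQ => //; right.
have G a b c d : - r <= a -> a <= b -> b <= r -> - r <= c -> c <= d -> d <= r ->
    [\/ b <= - s, s <= a, d <= - s | s <= c] -> circ P Q a b c d = 0.
  move=> ra ab br rc cd dr h; apply: goursat => // x y /andP[ax xb] /andP[cy yd].
  apply: cl'; try (apply/andP; split; lra).
  by case: h => h; [constructor 1|constructor 2|constructor 3|constructor 4]; lra.
rewrite (G (- r) (- s) (- r) r)//; last by constructor 1.
rewrite (G s r (- r) r)//; last by constructor 2.
rewrite (G (- s) s (- r) (- s))//; last by constructor 3.
rewrite (G (- s) s s r)//; last by constructor 4.
by rewrite !add0r !addr0.
Qed.

End Cauchy.

(** * Cauchy's estimate for the first derivative *)

Section CauchyEstimate.
Variable R : realType.
Implicit Types (r s d e M x y : R) (t z : R[i]) (g k : R[i]^o -> R[i]^o).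

(* The outward flux of [k] through a square is at most [(2 M - d r) / (2 r ^ 2)]
   per unit length; it vanishes since [t * k t] tends to 0 at 0. *)
Lemma cauchy_estimate_real g r M d : 0 < r ->
  (forall t, `|complex.Re t| <= r -> `|complex.Im t| <= r -> derivable g t (1 : R[i]^o)) ->
  (forall t, `|complex.Re t| <= r -> `|complex.Im t| <= r -> cabs (g t) <= M) ->
  is_derive (0 : R[i]^o) (1 : R[i]^o) g d%:C -> d <= 2 * M / r.
Proof.
move=> r0 dg gM g'0; rewrite leNgt ltr_pdivrMr//; apply/negP => dM.
pose k : R[i]^o -> R[i]^o := fun t => (g t - g 0) / t ^+ 2 - d%:C / t.
pose P x y := complex.Im (k (x +i* y)); pose Q x y := complex.Re (k (x +i* y)).
have nz x y : 0 < `|x| \/ 0 < `|y| -> x +i* y != 0.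
  by rewrite !normr_gt0 eq_complex/= negb_and => -[->|->]//; rewrite orbT.
have n2_gt0 x y : 0 < `|x| \/ 0 < `|y| -> 0 < x ^+ 2 + y ^+ 2.
  by move=> h; rewrite -cabs_sqr exprn_gt0// -ltcR cabsE normr_gt0; exact: nz.
have cl x y : `|x| <= r -> `|y| <= r -> 0 < `|x| \/ 0 < `|y| -> closed_at P Q x y.
  move=> xr yr h0; pose t : R[i] := x +i* y; have t0 : t != 0 := nz _ _ h0.
  suff [c hc] : exists c, is_derive (t : R[i]^o) (1 : R[i]^o) k c.
    exact: cderiv_closed_at (is_derive_cderiv_at hc).
  have t20 : t ^+ 2 != 0 by rewrite expf_neq0.
  have idt := @derivable_id R[i] R[i]^o t 1.
  have h1 := @derivableV R[i] R[i]^o (id ^+ 2) t 1 t20 (derivableX idt).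
  have h2 := @derivableV R[i] R[i]^o id t 1 t0 idt.
  have h3 := @derivableM R[i] R[i]^o _ _ t 1
    (derivableB (dg t xr yr) (@derivable_cst R[i] R[i]^o R[i]^o (g 0) t 1)) h1.
  have h4 := @derivableM R[i] R[i]^o _ _ t 1 (@derivable_cst R[i] R[i]^o R[i]^o d%:C t 1) h2.
  have kd := derivableB h3 h4.
  (* The function built by the derivability lemmas is convertible to [k]; unification exposes it so
     that it can be folded. *)
  have kk : (_ - _) = k := erefl.
  rewrite kk in kd.
  by exists ('D_1 k t : R[i]^o); exact: (DeriveDef kd erefl).
have M0 : 0 <= M by apply: le_trans (gM 0 _ _); rewrite ?cabs_ge0//= normr0 ltW.
have kE x y : `|x| <= r -> `|y| <= r -> 0 < `|x| \/ 0 < `|y| ->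
    cabs (k (x +i* y) + d%:C / (x +i* y)) <= 2 * M / (x ^+ 2 + y ^+ 2).
  move=> xr yr /n2_gt0 h; rewrite /k subrK cabsM cabsV expr2 cabsM -expr2 cabs_sqr.
  rewrite ler_pM2r ?invr_gt0//; apply: le_trans (cabsD _ _) _.
  by rewrite cabsN mulr_natl mulr2n lerD//; apply: gM; rewrite //= normr0 ltW.
have QE x y : `|x| <= r -> `|y| <= r -> 0 < `|x| \/ 0 < `|y| ->
    `|Q x y + d * (x / (x ^+ 2 + y ^+ 2))| <= 2 * M / (x ^+ 2 + y ^+ 2).
  move=> xr yr h; apply: le_trans (kE _ _ xr yr h); apply: le_trans (Re_le_cabs _).
  rewrite /Q; case: (k _) => a b /=; rewrite le_eqVlt; apply/orP; left; apply/eqP.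
  by congr `|_|; rewrite mul0r subr0.
have PE x y : `|x| <= r -> `|y| <= r -> 0 < `|x| \/ 0 < `|y| ->
    `|P x y - d * (y / (x ^+ 2 + y ^+ 2))| <= 2 * M / (x ^+ 2 + y ^+ 2).
  move=> xr yr h; apply: le_trans (kE _ _ xr yr h); apply: le_trans (Im_le_cabs _).
  rewrite /P; case: (k _) => a b /=; rewrite le_eqVlt; apply/orP; left; apply/eqP.
  by congr `|_|; rewrite mul0r addr0 mulrN.
(* On the square [x ^+ 2 + y ^+ 2 <= 2 * r ^+ 2], so [c] bounds
   [(d * r - 2 * M) / (x ^+ 2 + y ^+ 2)] from below; it is positive by the assumption to be
   refuted. *)
pose c := (d * r - 2 * M) / (2 * r ^+ 2).
have r2 : 0 < r ^+ 2 by rewrite exprn_gt0.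
have c0 : 0 < c by rewrite divr_gt0 ?subr_gt0// mulr_gt0.
have cE x y : `|x| <= r -> `|y| <= r -> 0 < `|x| \/ 0 < `|y| ->
    c <= d * (r / (x ^+ 2 + y ^+ 2)) - 2 * M / (x ^+ 2 + y ^+ 2).
  move=> xr yr /n2_gt0 h; rewrite mulrA -mulrBl /c ler_pM2l ?subr_gt0//.
  rewrite lef_pV2 ?posrE ?mulr_gt0//.
  have xx : x ^+ 2 <= r ^+ 2 by rewrite -real_normK ?num_real// ler_sqr ?nnegrE// ltW.
  have yy : y ^+ 2 <= r ^+ 2 by rewrite -(real_normK (num_real y)) ler_sqr ?nnegrE// ltW.
  by rewrite mulr_natl mulr2n lerD.
have rr : `|r| = r by rewrite gtr0_norm.
have rr' : `|r| <= r by rewrite rr.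
have Nrr : `|- r| <= r by rewrite normrN rr.
have r0' : 0 < `|r| by rewrite rr.
have Nr0' : 0 < `|- r| by rewrite normrN rr.
have Nrr2 : - r <= r by lra.
have big : circ P Q (- r) r (- r) r <= - c * (8 * r).
  have h1 : itg (- r) r (P ^~ (- r)) <= (- c) * (r - - r).
    apply: itg_ub => // x; rewrite -?ler_norml => xr.
      by apply: (closed_at_contP (Q := Q)); apply: cl => //; right.
    have := PE x _ xr Nrr (or_intror Nr0'); have := cE x _ xr Nrr (or_intror Nr0').
    by rewrite sqrrN mulNr mulrN ler_norml => ? /andP[_]; lra.
  have h2 : itg (- r) r (Q r) <= (- c) * (r - - r).
    apply: itg_ub => // y; rewrite -?ler_norml => yr.
      by apply: (closed_at_contQ (P := P)); apply: cl => //; left.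
    have := QE _ y rr' yr (or_introl r0'); have := cE _ y rr' yr (or_introl r0').
    by rewrite ler_norml => ? /andP[_]; lra.
  have h3 : c * (r - - r) <= itg (- r) r (P ^~ r).
    apply: itg_lb => // x; rewrite -?ler_norml => xr.
      by apply: (closed_at_contP (Q := Q)); apply: cl => //; right.
    have := PE x _ xr rr' (or_intror r0'); have := cE x _ xr rr' (or_intror r0').
    by rewrite ler_norml => ? /andP[+ _]; lra.
  have h4 : c * (r - - r) <= itg (- r) r (Q (- r)).
    apply: itg_lb => // y; rewrite -?ler_norml => yr.
      by apply: (closed_at_contQ (P := P)); apply: cl => //; left.
    have := QE _ y Nrr yr (or_introl Nr0'); have := cE _ y Nrr yr (or_introl Nr0').
    by rewrite sqrrN mulNr mulrN ler_norml => ? /andP[+ _]; lra.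
  by rewrite /circ; lra.
(* With this error [k] has modulus at most [r * c / 2 / s] on a small square of perimeter [8 * s],
   so the circulation there is at least [- (4 * (r * c))], against at most [- (8 * (r * c))] on the
   large square. *)
have e0 : 0 < r * c / 2 by rewrite divr_gt0// mulr_gt0.
have [del del0 small] := is_derive_cderiv_at g'0 e0.
pose s := Num.min r (del / 2).
have s0 : 0 < s by rewrite lt_min r0 divr_gt0.
have sr : s <= r by rewrite ge_min lexx.
have sd : s <= del / 2 by rewrite ge_min lexx orbT.
have E : circ P Q (- r) r (- r) r = circ P Q (- s) s (- s) s.
  apply: circ_annulus => // x y xr yr h; apply: cl => //.
  by case: h => h; [left|right]; exact: lt_le_trans h.
have kS x y : `|x| <= s -> `|y| <= s -> `|x| = s \/ `|y| = s ->
    cabs (k (x +i* y)) <= r * c / 2 / s.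
  move=> xs ys h; set t : R[i] := x +i* y.
  have t0 : t != 0 by apply: nz; case: h => ->; [left|right].
  have ct0 : 0 < cabs t by rewrite -ltcR cabsE normr_gt0.
  have st : s <= cabs t.
    by case: h => <-; [exact: (Re_le_cabs t)|exact: (Im_le_cabs t)].
  have := small t; rewrite !subr0 => /(_ _)/wrap[].
    by apply: le_trans (cabs_le_ReIm _) _ => /=; lra.
  move=> le; have -> : k t = (g t - g 0 - d%:C * t) / t ^+ 2.
    by rewrite /k; move: (g t : R[i]) (g 0 : R[i]) => a b; field.
  rewrite cabsM cabsV expr2 cabsM invfM mulrA.
  apply: (@le_trans _ _ (r * c / 2 / cabs t)).
    by rewrite ler_pM2r ?invr_gt0// ler_pdivrMr.
  by rewrite ler_pM2l// lef_pV2.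
have ss : `|s| = s by rewrite gtr0_norm.
have ss' : `|s| <= s by rewrite ss.
have Ns : `|- s| = s by rewrite normrN ss.
have Nss : `|- s| <= s by rewrite Ns.
have Nss2 : - s <= s by lra.
have clS x y : `|x| <= s -> `|y| <= s -> `|x| = s \/ `|y| = s -> closed_at P Q x y.
  by move=> xs ys h; apply: cl; rewrite ?(le_trans _ sr)//; case: h => ->; [left|right].
have h1 : - (r * c / 2 / s) * (s - - s) <= itg (- s) s (P ^~ (- s)).
  apply: itg_lb => // x; rewrite -?ler_norml => xs.
    by apply: (closed_at_contP (Q := Q)); apply: clS => //; right.
  by have := le_trans (Im_le_cabs _) (kS x _ xs Nss (or_intror Ns)); rewrite ler_norml => /andP[].
have h2 : - (r * c / 2 / s) * (s - - s) <= itg (- s) s (Q s).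
  apply: itg_lb => // y; rewrite -?ler_norml => ys.
    by apply: (closed_at_contQ (P := P)); apply: clS => //; left.
  by have := le_trans (Re_le_cabs _) (kS _ y ss' ys (or_introl ss)); rewrite ler_norml => /andP[].
have h3 : itg (- s) s (P ^~ s) <= (r * c / 2 / s) * (s - - s).
  apply: itg_ub => // x; rewrite -?ler_norml => xs.
    by apply: (closed_at_contP (Q := Q)); apply: clS => //; right.
  by have := le_trans (Im_le_cabs _) (kS x _ xs ss' (or_intror ss)); rewrite ler_norml => /andP[].
have h4 : itg (- s) s (Q (- s)) <= (r * c / 2 / s) * (s - - s).
  apply: itg_ub => // y; rewrite -?ler_norml => ys.
    by apply: (closed_at_contQ (P := P)); apply: clS => //; left.
  by have := le_trans (Re_le_cabs _) (kS _ y Nss ys (or_introl Ns)); rewrite ler_norml => /andP[].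
have H : - (4 * (r * c)) <= circ P Q (- s) s (- s) s.
  have e2 : r * c / 2 / s * (s - - s) = r * c by field; rewrite gt_eqF.
  by rewrite !mulNr !e2 in h1 h2 h3 h4; rewrite /circ; lra.
by rewrite E in big; nra.
Qed.

(** Multiplying [g] by the unimodular [|d| / d] makes the derivative equal to [|d|], which reduces
    to the real case. *)
Lemma cauchy_estimate g r M (d : R[i]) : 0 < r ->
  (forall t, `|complex.Re t| <= r -> `|complex.Im t| <= r -> derivable g t (1 : R[i]^o)) ->
  (forall t, `|complex.Re t| <= r -> `|complex.Im t| <= r -> cabs (g t) <= M) ->
  is_derive (0 : R[i]^o) (1 : R[i]^o) g d -> cabs d <= 2 * M / r.
Proof.
move=> r0 dg gM g'0; have [->|d0] := eqVneq d 0.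
  rewrite /cabs rnorm0 divr_ge0 ?(ltW r0)// mulr_ge0//.
  by apply: le_trans (gM 0 _ _); rewrite ?cabs_ge0//= normr0 ltW.
have nd0 : `|d| != 0 by rewrite normr_eq0.
pose u : R[i] := `|d| / d.
have u1 : cabs u = 1.
  by apply: complexI; rewrite cabsE normrM normfV normr_id divff.
apply: (@cauchy_estimate_real (fun t => u *: g t)) r0 _ _ _.
- by move=> t tr ti; apply: derivableZ; exact: dg.
- by move=> t tr ti; rewrite [u *: g t]/(u * g t) cabsM u1 mul1r; exact: gM.
- have -> : (cabs d)%:C = u *: (d : R[i]^o) by rewrite cabsE; exact: esym (divfK d0 `|d|).
  exact: is_deriveZ.
Qed.

End CauchyEstimate.

(** * A second-order Taylor bound depending only on a bound of the function *)

Section Taylor.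
Variable R : realType.
Implicit Types (x K M : R) (a s t : R[i]) (g : R[i]^o -> R[i]^o).

Lemma real_is_derive (phi : R -> R) x (df : R) :
  (forall e, 0 < e -> exists2 del, 0 < del & forall y, `|y - x| <= del ->
    `|phi y - phi x - df * (y - x)| <= e * `|y - x|) ->
  is_derive x 1 phi df.
Proof.
move=> H; have cv : (fun h : R => h^-1 *: (phi (h *: 1 + x) - phi x)) @ 0^' --> df.
  apply/cvgrPdist_le => e e0; have [del del0 hd] := H e e0.
  near=> h.
  have h0 : h != 0 by near: h; exact: nbhs_dnbhs_neq.
  have := hd (h + x); rewrite addrK.
  have hdel : `|h| <= del.
    by near: h; exact: dnbhs0_le.
  move=> /(_ hdel); rewrite [h *: 1]mulr1 => le.
  rewrite -(ler_pM2r (x := `|h|)) ?normr_gt0// -normrM -normrN.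
  by apply: le_trans le; rewrite le_eqVlt; apply/orP; left; apply/eqP; congr `|_|;
    rewrite /GRing.scale/=; field.
have dphi : derivable phi x 1 by apply/cvg_ex; exists df.
by apply: DeriveDef => //; exact: (@cvg_lim _ _ _ (dnbhs _)).
Unshelve. all: by end_near. Qed.

(** The real mean value theorem along the segment is applied to the real and imaginary parts
    separately, which costs the factor 2. Both are covered by [bound], for a real-linear [p]
    dominated by the modulus. *)
Lemma complex_mvt g a s K : 0 <= K ->
  (forall x, 0 <= x <= 1 -> exists2 d : R[i],
     is_derive (a + x%:C * s : R[i]^o) (1 : R[i]^o) g d & cabs d <= K) ->
  cabs (g (a + s) - g a) <= 2 * K * cabs s.
Proof.
move=> K0 H.
have /choice[d dP] x : exists d : R[i], 0 <= x <= 1 ->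
    is_derive (a + x%:C * s : R[i]^o) (1 : R[i]^o) g d /\ cabs d <= K.
  have [/H[d gd dK]|n] := boolP (0 <= x <= 1); first by exists d.
  by exists 0.
have bound (p : R[i] -> R) : (forall z, `|p z| <= cabs z) ->
    (forall z w, p (z - w) = p z - p w) -> (forall x z, p (x%:C * z) = x * p z) ->
    `|p (g (a + s) - g a)| <= K * cabs s.
  move=> pc pB pZ; pose phi x := p (g (a + x%:C * s)).
  have dphi x : 0 <= x <= 1 -> is_derive x 1 phi (p (d x * s)).
    move=> /dP[/is_derive_cderiv_at gd _]; apply: real_is_derive => e e0.
    have [|del del0 hd] := gd (e / (1 + cabs s)).
      by rewrite divr_gt0// ltr_wpDr ?cabs_ge0.
    have s1 : 0 < 1 + cabs s by rewrite ltr_wpDr ?cabs_ge0.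
    exists (del / (1 + cabs s)); first by rewrite divr_gt0.
    move=> y yx; have E : a + y%:C * s - (a + x%:C * s) = (y - x)%:C * s by rewrite rmorphB/=; ring.
    have := hd (a + y%:C * s); rewrite E cabsM cabs_real.
    have -> : phi y - phi x - p (d x * s) * (y - x) =
        p (g (a + y%:C * s) - g (a + x%:C * s) - d x * ((y - x)%:C * s)).
      by rewrite !pB mulrCA pZ [(y - x) * _]mulrC.
    move=> /(_ _)/wrap[].
      move: yx; rewrite ler_pdivlMr//; apply: le_trans.
      by rewrite ler_wpM2l// lerDr.
    move=> le; apply: le_trans (pc _) _; apply: le_trans le _.
    have -> : e / (1 + cabs s) * (`|y - x| * cabs s) =
      e * `|y - x| * (cabs s / (1 + cabs s)) by ring.
    by rewrite ler_piMr ?mulr_ge0 ?(ltW e0)// ler_pdivrMr// mul1r lerDr.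
  have [| |c c01] := @MVT_segment R phi (fun x => p (d x * s)) 0 1 ler01.
  - by move=> x; rewrite in_itv/= => /andP[x0 x1]; apply: dphi; rewrite !ltW.
  - apply: continuous_in_subspaceT => x /set_mem/=; rewrite in_itv/= => x01.
    have dx := dphi _ x01.
    by apply/differentiable_continuous/derivable1_diffP; exact: ex_derive.
  - move: c01; rewrite in_itv/= subr0 mulr1 /phi mul1r mul0r addr0 -pB => /dP[_ dK] ->.
    by apply: le_trans (pc _) _; rewrite cabsM ler_wpM2r ?cabs_ge0.
apply: le_trans (cabs_le_ReIm _) _; rewrite -mulrA mulr_natl mulr2n lerD//.
  apply: bound; [exact: Re_le_cabs|by case=> ? ? []|].
  by move=> x [u w]/=; rewrite mul0r subr0.
apply: bound; [exact: Im_le_cabs|by case=> ? ? []|].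
by move=> x [u w]/=; rewrite mul0r addr0.
Qed.

Lemma cabs_ge_ReIm (a t : R[i]) x M : cabs a <= M ->
  `|complex.Re t| <= x -> `|complex.Im t| <= x -> cabs (a + t) <= M + 2 * x.
Proof.
move=> aM tr ti; apply: le_trans (cabsD _ _) _; rewrite lerD//.
by apply: le_trans (cabs_le_ReIm _) _; rewrite mulr_natl mulr2n lerD.
Qed.

Lemma is_derive_translate g a t (d : R[i]) :
  is_derive (a + t : R[i]^o) (1 : R[i]^o) g d ->
  is_derive (t : R[i]^o) (1 : R[i]^o) (fun z => g (a + z)) d.
Proof.
move=> [dg gd]; have E : (fun h : R[i] =>
    h^-1 *: (((fun z : R[i]^o => g (a + z)) \o shift t) (h *: (1 : R[i]^o)) - g (a + t)))
    = (fun h : R[i] => h^-1 *: ((g \o shift (a + t)) (h *: (1 : R[i]^o)) - g (a + t))).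
  by apply/funext => h /=; rewrite addrCA.
by apply: DeriveDef; rewrite ?/derivable ?/derive E.
Qed.

(** The derivative is shown to be Lipschitz at 0 without differentiating it: Cauchy's estimate on a
    square of half side 1/2 is applied to the increment [g (s + t) - g t], itself at most
    [4 * M * cabs s]. This gives [16 * M * cabs s], and the mean value bound for [g t - D 0 * t]
    doubles it. *)
Lemma taylor1 g M : 0 <= M ->
  (forall t, cabs t <= 4 -> derivable g t (1 : R[i]^o)) ->
  (forall t, cabs t <= 4 -> cabs (g t) <= M) ->
  forall s, cabs s <= 1 ->
    cabs (g s - g 0 - 'D_1 g (0 : R[i]^o) * s) <= 32 * M * cabs s ^+ 2.
Proof.
move=> M0 dg gM; pose D (t : R[i]) : R[i] := 'D_1 g (t : R[i]^o).
have gD t : cabs t <= 4 -> is_derive (t : R[i]^o) (1 : R[i]^o) g (D t).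
  by move=> /dg ?; exact: DeriveDef.
(* The square of half side 1 around [a] stays in the disc of radius 4, as its points differ from [a]
   by at most 2. *)
have D2 a : cabs a <= 2 -> cabs (D a) <= 2 * M.
  move=> a2; rewrite -[leRHS]divr1.
  apply: (@cauchy_estimate _ (fun t => g (a + t)) 1 M (D a) ltr01) => [t tr ti|t tr ti|].
  - have h : cabs (a + t) <= 4 by have := cabs_ge_ReIm a2 tr ti; lra.
    by have [] := is_derive_translate (gD _ h).
  - by apply: gM; have := cabs_ge_ReIm a2 tr ti; lra.
  - by apply: is_derive_translate; rewrite addr0; apply: gD; lra.
have lip a s : cabs a <= 1 -> cabs s <= 1 -> cabs (g (a + s) - g a) <= 4 * M * cabs s.
  move=> a1 s1; have -> : 4 * M = 2 * (2 * M) by ring.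
  apply: complex_mvt; first by rewrite mulr_ge0.
  move=> x /andP[x0 x1]; have as2 : cabs (a + x%:C * s) <= 2.
    apply: le_trans (cabsD _ _) _; rewrite cabsM cabs_real ger0_norm//.
    by have := cabs_ge0 s; nra.
  by exists (D (a + x%:C * s)); [apply: gD; lra|exact: D2].
have D1 s : cabs s <= 1 -> cabs (D s - D 0) <= 16 * M * cabs s.
  move=> s1; have -> : 16 * M * cabs s = 2 * (4 * M * cabs s) / 2^-1 by field.
  have h1 (t : R[i]) : `|complex.Re t| <= 2^-1 -> `|complex.Im t| <= 2^-1 -> cabs t <= 1.
    by move=> tr ti; have := cabs_le_ReIm t; lra.
  have st (t : R[i]) : cabs t <= 1 -> cabs (s + t) <= 4.
    by move=> ?; have := cabsD s t; lra.
  have h0 : 0 < 2^-1 :> R by rewrite invr_gt0.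
  apply: (@cauchy_estimate _ (fun t => g (s + t) - g t) _ _ (D s - D 0) h0) => [t tr ti|t tr ti|].
  - have t1 := h1 _ tr ti.
    apply: derivableB; last by apply: dg; lra.
    by have [] := is_derive_translate (gD _ (st _ t1)).
  - by rewrite (addrC s); exact: lip (h1 _ tr ti) s1.
  - apply: is_deriveB; last by apply: gD; rewrite /cabs rnorm0.
    by apply: is_derive_translate; rewrite addr0; apply: gD; lra.
move=> s s1; pose h (t : R[i]^o) : R[i]^o := g t - D 0 *: t.
have -> : g s - g 0 - 'D_1 g (0 : R[i]^o) * s = h (0 + s) - h 0.
  by rewrite /h add0r scaler0 subr0 addrAC.
have -> : 32 * M * cabs s ^+ 2 = 2 * (16 * M * cabs s) * cabs s by ring.
apply: complex_mvt; first by rewrite !mulr_ge0 ?cabs_ge0.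
move=> x /andP[x0 x1]; rewrite add0r.
have xs : cabs (x%:C * s) <= cabs s.
  by rewrite cabsM cabs_real ger0_norm// ler_piMl// cabs_ge0.
exists (D (x%:C * s) - D 0).
  apply: is_deriveB; first by apply: gD; lra.
  rewrite -[X in is_derive _ _ _ X](mulr1 (D 0)); apply: is_deriveZ.
apply: le_trans (D1 _ _) _; first by lra.
by rewrite ler_wpM2l// mulr_ge0.
Qed.

End Taylor.

(** * Norming functionals through sublinear minorants *)

Section HahnBanach.
Variables (R : realType) (F : normedModType R[i]).
Implicit Types (p q : F -> R) (x y : F).

Definition sublinear p := (forall x y, p (x + y) <= p x + p y) /\
  (forall r x, 0 < r -> p (r%:C *: x) <= r * p x).

Lemma sublinear0 p : sublinear p -> p 0 = 0.
Proof.
move=> [pD pZ]; have := pD 0 0; have := pZ (2^-1) 0.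
by rewrite scaler0 addr0 invr_gt0 ltr0n => /(_ isT) h1 h2; lra.
Qed.

Lemma sublinear_geN p x : sublinear p -> - p (- x) <= p x.
Proof.
move=> ps; have := sublinear0 ps; case: ps => + _ => /(_ x (- x)).
by rewrite subrr => + p0; rewrite p0; lra.
Qed.

Lemma sublinearZ p (r : R) x : sublinear p -> 0 < r -> p (r%:C *: x) = r * p x.
Proof.
move=> [_ pZ] r0; apply/le_anti; rewrite pZ//=.
have ri : 0 < r^-1 by rewrite invr_gt0.
have := pZ r^-1 (r%:C *: x) ri; rewrite scalerA -rmorphM/= mulVf ?gt_eqF// scale1r.
by rewrite mulrC ler_pdivlMr// mulrC.
Qed.

Lemma sublinear_rnorm : sublinear (@rnorm R F).
Proof.
split=> [|r x r0]; first exact: ler_rnormD.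
by rewrite rnormZ -/(cabs _) cabs_real gtr0_norm.
Qed.

(** The witness is the infimum over [t > 0] of [p (x + t y) - t p y], bounded below by [- p (- x)].
    At [x = - y] the last bound reads [q (- y) <= - p y], so an additive functional below [q] is at
    least [p y] at [y]. *)
Lemma sublinear_dir p y : sublinear p -> exists q, [/\ sublinear q,
  (forall x, q x <= p x) & (forall x, q x <= p (x + y) - p y)].
Proof.
move=> ps; have [pD pZ] := ps.
pose S x := [set p (x + t%:C *: y) - t * p y | t in [set t : R | 0 < t]].
have Slb x : lbound (S x) (- p (- x)).
  move=> _ [t /= t0 <-]; have := pD (x + t%:C *: y) (- x).
  by rewrite addrAC subrr add0r (sublinearZ _ ps t0); lra.
have Shas x : has_inf (S x).
  by split; [exists (p (x + 1%:C *: y) - 1 * p y), 1 => //=|exists (- p (- x)); exact: Slb].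
pose q x := inf (S x).
have qle x t : 0 < t -> q x <= p (x + t%:C *: y) - t * p y.
  by move=> t0; apply: ge_inf; [exact: (Shas x).2|exists t].
have leq x z : (forall t, 0 < t -> z <= p (x + t%:C *: y) - t * p y) -> z <= q x.
  by move=> h; apply: lb_le_inf => [|_ [t /= t0 <-]]; [exact: (Shas x).1|exact: h].
exists q; split.
- split=> [x1 x2|r x r0].
    have H t1 : 0 < t1 -> q (x1 + x2) - (p (x1 + t1%:C *: y) - t1 * p y) <= q x2.
      move=> t10; apply: leq => t2 t20; rewrite lerBlDr.
      apply: le_trans (qle _ (t1 + t2) (addr_gt0 t10 t20)) _.
      have := pD (x1 + t1%:C *: y) (x2 + t2%:C *: y).
      by rewrite rmorphD/= scalerDl addrACA; lra.
    by rewrite -lerBlDr; apply: leq => t1 /H; lra.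
  have ri : 0 < r^-1 by rewrite invr_gt0.
  rewrite -ler_pdivrMl//; apply: leq => t t0; rewrite ler_pdivrMl//.
  apply: le_trans (qle _ (r * t) (mulr_gt0 r0 t0)) _.
  by rewrite rmorphM/= -scalerA -scalerDr (sublinearZ _ ps r0); lra.
- move=> x; apply/ler_addgt0Pl => e e0.
  have p0 : 0 <= `|p y| + `|p (- y)| by rewrite addr_ge0.
  pose t := e / (`|p y| + `|p (- y)| + 1).
  have k0 : 0 < `|p y| + `|p (- y)| + 1 by lra.
  have t0 : 0 < t by rewrite divr_gt0.
  apply: le_trans (qle x t t0) _; have := pD x (t%:C *: y).
  by rewrite (sublinearZ _ ps t0); lra.
- by move=> x; have := qle x 1 ltr01; rewrite scale1r mul1r.
Qed.

(* A minimal sublinear minorant is additive, since the functional of [sublinear_dir]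
   cannot lie strictly below it. *)
Lemma sublinear_minorant p : sublinear p ->
  exists q, [/\ sublinear q, (forall x, q x <= p x) & (forall x y, q (x + y) = q x + q y)].
Proof.
move=> ps.
pose T := {q | sublinear q /\ forall x, q x <= p x}.
(* The order is reversed: a maximal element for Zorn's lemma is a minimal minorant. *)
pose le (q q' : T) := `[< forall x, sval q' x <= sval q x >].
have [| | |[q [qs qp]] qmax] := @ZL_preorder T (exist _ p (conj ps (fun x => lexx _))) le.
- by move=> q; apply/asboolP.
- move=> q1 q2 q3 /asboolP h1 /asboolP h2; apply/asboolP => x.
  exact: le_trans (h2 x) (h1 x).
- move=> A tot; have [[q0 Aq0]|A0] := pselect (A !=set0); last first.
    by exists (exist _ p (conj ps (fun x => lexx _))) => s As; case: A0; exists s.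
  pose S x := [set sval q x | q in A].
  have Shas x : has_inf (S x).
    split; first by exists (sval q0 x), q0.
    exists (- p (- x)) => _ [[q [qs qp]] Aq <-]/=.
    by apply: le_trans (sublinear_geN _ qs); rewrite lerN2.
  have Sle x (q : T) : A q -> inf (S x) <= sval q x.
    by move=> Aq; apply: ge_inf; [exact: (Shas x).2|exists q].
  have leS x z : (forall q : T, A q -> z <= sval q x) -> z <= inf (S x).
    by move=> h; apply: lb_le_inf => [|_ [q Aq <-]]; [exact: (Shas x).1|exact: h].
  suff bs : sublinear (fun x => inf (S x)) /\ forall x, inf (S x) <= p x.
    by exists (exist _ (fun x => inf (S x)) bs) => q Aq; apply/asboolP => x /=; exact: Sle.
  split; last by move=> x; apply: le_trans (Sle x q0 Aq0) _; exact: (svalP q0).2.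
  split=> [x y|r x r0].
    (* The pointwise infimum of a chain is subadditive because, of two members, the smaller one
       serves for both [x] and [y]. *)
    have H (q1 : T) : A q1 -> inf (S (x + y)) - sval q1 x <= inf (S y).
      move=> A1; apply: leS => q2 A2; rewrite lerBlDr.
      have [/asboolP h|/asboolP h] := tot q1 q2 A1 A2.
        apply: le_trans (Sle _ _ A2) _; apply: le_trans ((svalP q2).1.1 _ _) _.
        by rewrite addrC lerD2l.
      apply: le_trans (Sle _ _ A1) _; apply: le_trans ((svalP q1).1.1 _ _) _.
      by rewrite addrC lerD2r.
    by rewrite -lerBlDr; apply: leS => q1 /H; lra.
  rewrite -ler_pdivrMl//; apply: leS => q1 A1; rewrite ler_pdivrMl//.
  by apply: le_trans (Sle _ _ A1) _; exact: (svalP q1).1.2.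
- exists q; split=> // x y; apply/le_anti; rewrite qs.1/=.
  have [q' [q's q'q q'y]] := sublinear_dir y qs.
  have q'p : sublinear q' /\ forall x, q' x <= p x.
    by split=> // z; exact: le_trans (q'q z) (qp z).
  have /asboolP/(_ x)/= h := qmax (exist _ q' q'p) (asboolT q'q).
  by have := q'y x; lra.
Qed.

(** An additive minorant [q] of the norm with [q y >= rnorm y] comes from [sublinear_dir]; being odd
    and positively homogeneous it is real-linear, and [q x - i q (i x)] is its complexification. Its
    real and imaginary parts are each bounded by the norm, whence the 2. *)
Lemma norming_functional y : exists Psi : {linear F -> R[i]^o},
  rnorm y <= rnorm (Psi y) /\ forall x, rnorm (Psi x) <= 2 * rnorm x.
Proof.
have [p [ps pn py]] := sublinear_dir y sublinear_rnorm.
have [q [qs qp qD]] := sublinear_minorant ps.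
have qn x : q x <= rnorm x := le_trans (qp x) (pn x).
have q0 := sublinear0 qs.
have qN x : q (- x) = - q x.
  by have := qD x (- x); rewrite subrr q0; lra.
have qa x : `|q x| <= rnorm x.
  rewrite ler_norml qn andbT lerNl -qN; apply: le_trans (qn _) _.
  by rewrite /rnorm normrN.
have qZ (r : R) x : q (r%:C *: x) = r * q x.
  have [r0|r0|->] := ltgtP r 0.
  - have r0' : 0 < - r by rewrite oppr_gt0.
    have := sublinearZ x qs r0'; rewrite rmorphN/= scaleNr qN mulNr.
    exact: oppr_inj.
  - exact: sublinearZ.
  - by rewrite scale0r mul0r q0.
pose Psi (x : F) : R[i]^o := q x -i* q ('i%C *: x).
have PsiL : linear Psi.
  move=> [a b] x z; rewrite /Psi.
  have -> : (a +i* b) *: x = a%:C *: x + b%:C *: ('i%C *: x).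
    rewrite scalerA -scalerDl; congr (_ *: _); apply/eqP.
    by rewrite eq_complex/=; apply/andP; split; apply/eqP; ring.
  have -> : 'i%C *: (a%:C *: x + b%:C *: ('i%C *: x) + z) =
      a%:C *: ('i%C *: x) + (- b)%:C *: x + 'i%C *: z.
    rewrite !scalerDr !scalerA; congr (_ *: x + _ *: x + _); first by rewrite mulrC.
    by apply/eqP; rewrite eq_complex/=; apply/andP; split; apply/eqP; ring.
  rewrite !qD !qZ; apply/eqP; rewrite eq_complex/=.
  by apply/andP; split; apply/eqP; ring.
pose isL := GRing.isLinear.Build _ _ _ _ Psi PsiL.
pose PsiL' : {linear F -> R[i]^o} := HB.pack Psi isL.
exists PsiL'; split=> [|x] /=.
  apply: le_trans (Re_le_cabs (Psi y)) => /=; apply: le_trans (ler_norm _).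
  have := py (- y); rewrite addNr rnorm0 sub0r.
  by have := qp (- y); rewrite qN; lra.
apply: le_trans (cabs_le_ReIm (Psi x)) _ => /=; rewrite mulr_natl mulr2n lerD//.
rewrite normrN; apply: le_trans (qa _) _; rewrite rnormZ.
by rewrite /rnorm normc_def/= expr0n add0r expr1n sqrtr1 mul1r.
Qed.

End HahnBanach.

(** * Limits of sequences with geometrically small increments *)

Section GeometricSequences.
Variable R : realType.

Lemma geo_eq0 (X : normedModType R[i]) (x : X) (K : R) :
  (forall n, rnorm x <= K / 2 ^+ n) -> x = 0.
Proof.
move=> h; apply: rnorm0_eq0; apply/le_anti; rewrite rnorm_ge0 andbT.
apply/ler_addgt0Pl => e e0; rewrite addr0; have [n] := half_pow_le K e0.
exact: le_trans (h n).
Qed.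

Lemma rnormN (X : normedModType R[i]) (x : X) : rnorm (- x) = rnorm x.
Proof. by rewrite /rnorm normrN. Qed.

Lemma rnormB (X : normedModType R[i]) (x y : X) : rnorm (x - y) = rnorm (y - x).
Proof. by rewrite -rnormN opprB. Qed.

Lemma ler_rnormB (X : normedModType R[i]) (x y z : X) :
  rnorm (x - z) <= rnorm (x - y) + rnorm (y - z).
Proof. by rewrite -[x - z](subrKA y) ler_rnormD. Qed.

Lemma geo_tail (X : normedModType R[i]) (u : nat -> X) (c : R) :
  (forall n, rnorm (u n.+1 - u n) <= c / 2 ^+ n) ->
  forall n k, rnorm (u n - u (n + k)%N) <= 2 * c / 2 ^+ n.
Proof.
move=> h n k.
have c0 : 0 <= c by have := le_trans (rnorm_ge0 _) (h 0%N); rewrite expr0 divr1.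
(* The exact value of the partial geometric sum is what the induction on [k] can carry. *)
apply: (@le_trans _ _ (2 * c / 2 ^+ n - 2 * c / 2 ^+ (n + k))); last first.
  by rewrite gerBl divr_ge0 ?mulr_ge0// ltW// expr2_gt0.
elim: k => [|k ih]; first by rewrite addn0 !subrr rnorm0.
apply: le_trans (ler_rnormB _ (u (n + k)%N) _) _.
rewrite addnS; apply: le_trans (lerD ih _) _; first by rewrite rnormB; exact: h.
have -> : 2 * c / 2 ^+ (n + k).+1 = c / 2 ^+ (n + k).
  by rewrite exprS invfM mulrACA divff// mul1r.
by rewrite -[2 * c / 2 ^+ (n + k)]mulrA; lra.
Qed.

(** The explicit rate lets pointwise limits of functionals become norm limits. The constant 4
    accommodates [R[i]], where the real and imaginary parts contribute 2 each. *)
Definition geo_complete (X : normedModType R[i]) :=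
  forall (u : nat -> X) (c : R), (forall n, rnorm (u n.+1 - u n) <= c / 2 ^+ n) ->
  exists l, forall n, rnorm (u n - l) <= 4 * c / 2 ^+ n.

Lemma complete_geo_complete (X : completeNormedModType R[i]) : geo_complete X.
Proof.
move=> u c h; have tl := geo_tail h.
have c0 : 0 <= c by have := le_trans (rnorm_ge0 _) (h 0%N); rewrite expr0 divr1.
have cu : cauchy (u @ \oo).
  apply: cauchy_exP => e e0.
  have er : e = (complex.Re e)%:C by rewrite RRe_real ?gtr0_real.
  have e0' : 0 < complex.Re e / 2 by rewrite divr_gt0// -ltcR -er.
  have [N hN] := half_pow_le (2 * c) e0'.
  exists (u N); exists N => // n /= Nn; rewrite -ball_normE/= -rnormE er ltcR.
  by have := tl N (n - N)%N; rewrite subnKC//; move: e0' hN; lra.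
have /cvg_ex[l ul] : cvg (u @ \oo) by exact: cauchy_cvg.
exists l => n; apply/ler_addgt0Pl => e e0.
have eC : 0 < e%:C :> R[i] by rewrite ltcR.
have /cvgrPdist_le/(_ _ eC)[N _ hN] := ul.
have := hN (maxn N n) (leq_maxl _ _); rewrite /= -rnormE lecR (rnormB l).
have := ler_rnormB (u n) (u (maxn N n)) l.
have := tl n (maxn N n - n)%N; rewrite subnKC ?leq_maxr//.
have : 0 <= c / 2 ^+ n by rewrite divr_ge0// ltW// expr2_gt0.
by rewrite -[4 * c / _]mulrA -[2 * c / _]mulrA; lra.
Qed.

(** The intervals centred at [u n] with radius [2 * c / 2 ^+ n] are nested. *)
Lemma real_geo_limit (u : nat -> R) c :
  (forall n, `|u n.+1 - u n| <= c / 2 ^+ n) ->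
  exists l, forall n, `|u n - l| <= 2 * c / 2 ^+ n.
Proof.
move=> h; have c0 : 0 <= c by have := le_trans (normr_ge0 _) (h 0%N); rewrite expr0 divr1.
have E n : c / 2 ^+ n.+1 = c / 2 ^+ n / 2 by rewrite exprSr invfM mulrA.
have [|||x xP] := @nested_point R (fun n => u n - 2 * (c / 2 ^+ n)) (4 * c).
- by move=> n; rewrite E; have := h n; rewrite ler_norml => /andP[]; lra.
- move=> n; rewrite -[4 * c / _]mulrA -[4 * c / 2 ^+ n]mulrA E.
  by have := h n; rewrite ler_norml => /andP[]; lra.
- by rewrite mulr_ge0.
exists x => n; have := xP n; rewrite -[4 * c / _]mulrA -[2 * c / _]mulrA.
by move=> /andP[? ?]; rewrite ler_norml; apply/andP; split; lra.
Qed.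

Lemma C_geo_complete : geo_complete R[i]^o.
Proof.
move=> u c h.
have [|a aP] := @real_geo_limit (fun n => complex.Re (u n)) c.
  move=> n; apply: le_trans (h n); apply: le_trans (Re_le_cabs _).
  by case: (u _) => ? ?; case: (u _).
have [|b bP] := @real_geo_limit (fun n => complex.Im (u n)) c.
  move=> n; apply: le_trans (h n); apply: le_trans (Im_le_cabs _).
  by case: (u _) => ? ?; case: (u _).
exists (a +i* b) => n; apply: le_trans (cabs_le_ReIm _) _.
have -> : 4 * c / 2 ^+ n = 2 * c / 2 ^+ n + 2 * c / 2 ^+ n by ring.
by apply: lerD; [apply: le_trans (aP n)|apply: le_trans (bP n)]; case: (u n).
Qed.

End GeometricSequences.

(** * Completeness of the predual *)

Section GvComplete.
Variables (R : realType) (E : normedModType R[i]) (U : set E) (v : weight U).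
Local Notation C := (R[i]^o).
Local Notation H := (Hv v C).
Local Notation G := (Gv v).
Implicit Types (phi : G) (f : H).

Lemma Gv_app0 phi : phi 0 = 0.
Proof. by have := Gv_linear phi (-1) 0 0; rewrite !scaleN1r !addNr. Qed.

Lemma Gv_appZ phi l f : phi (l *: f) = l *: phi f.
Proof. by have := Gv_linear phi l f 0; rewrite Gv_app0 !addr0. Qed.

Lemma Gv_app_le phi f : rnorm (phi f) <= rnorm phi * rnorm f.
Proof.
have [->|f0] := eqVneq f 0; first by rewrite Gv_app0 !rnorm0 mulr0.
have nf0 : 0 < rnorm f.
  by rewrite lt_neqAle rnorm_ge0 andbT eq_sym; apply/eqP => /rnorm0_eq0; exact/eqP.
have nf : rnorm ((rnorm f)^-1%:C : C) = (rnorm f)^-1.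
  by rewrite -/(cabs _) cabs_real gtr0_norm ?invr_gt0.
have := @Gv_norm_ub _ _ _ _ phi ((rnorm f)^-1%:C *: f).
rewrite /unit_ball/= rnormZ nf mulVf ?gt_eqF// => /(_ (lexx _)).
by rewrite Gv_appZ rnormZ nf ler_pdivrMl// mulrC rnorm_GvE.
Qed.

(** A uniform limit on the ball of functions continuous there is continuous, by the usual three-term
    estimate. This places in [Gv] both the limits of atoms and the derivative of the evaluation
    map. *)
Lemma Gv_unif_limit (u : nat -> G) (phi : H -> C) (K : R) : linear phi ->
  (forall n f, unit_ball f -> rnorm (u n f - phi f) <= K / 2 ^+ n) ->
  phi \in @Gv_pred _ _ _ v.
Proof.
move=> phil h; apply/mem_set; split=> //.
rewrite continuous_subspace_in => f0 /set_mem f0b; apply/cvgrPdist_le => e e0.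
have er : e = (complex.Re e)%:C by rewrite RRe_real ?gtr0_real.
have e0' : 0 < complex.Re e / 4 by rewrite divr_gt0// -ltcR -er.
have eC : 0 < (complex.Re e / 4)%:C :> R[i] by rewrite ltcR.
have [n nP] := half_pow_le K e0'.
have uc : {within (@unit_ball R H : set (Hv_co v)), continuous (u n : Hv_co v -> C)}.
  by case: (u n) => p /= /set_mem[].
have nA : nbhs (f0 : subspace (@unit_ball R H : set (Hv_co v))) (@unit_ball R H).
  by rewrite /nbhs/= -nbhs_subspace_in//; exact: withinT.
have /cvgrPdist_le/(_ _ eC) := uc f0.
apply: filterS2 nA => f fb.
rewrite -!(rnormE (_ : C)) lecR er lecR => hf'.
apply: le_trans (ler_rnormB _ (u n f0) _) _.
rewrite rnormB; have := h n _ f0b.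
have := ler_rnormB (u n f0 : C) (u n f) (phi f); have := h n _ fb.
by move: e0' nP hf'; lra.
Qed.

Lemma Gv_geo_complete : geo_complete G.
Proof.
move=> u c h; have c0 : 0 <= c.
  by have := le_trans (rnorm_ge0 _) (h 0%N); rewrite expr0 divr1.
have /choice[phi phiP] f : exists l : C, forall n,
    rnorm (u n f - l) <= 4 * (c * rnorm f) / 2 ^+ n.
  apply: C_geo_complete => n; have -> : u n.+1 f - u n f = (u n.+1 - u n) f by [].
  by apply: le_trans (Gv_app_le _ _) _; rewrite mulrAC ler_wpM2r ?rnorm_ge0.
have phil : linear phi.
  move=> a f g; apply/eqP; rewrite -subr_eq0; apply/eqP.
  apply: (@geo_eq0 _ _ _ (4 * (c * rnorm (a *: f + g)) +
    (rnorm (a : C) * (4 * (c * rnorm f)) + 4 * (c * rnorm g)))) => n.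
  rewrite mulrDl; apply: le_trans (ler_rnormB _ (u n (a *: f + g)) _) _.
  rewrite lerD//; first by rewrite rnormB.
  rewrite Gv_linear opprD addrACA -scalerBr mulrDl -mulrA.
  apply: le_trans (ler_rnormD _ _) _; rewrite lerD// rnormZ ler_wpM2l ?rnorm_ge0//.
have phiG : phi \in @Gv_pred _ _ _ v.
  apply: (@Gv_unif_limit u phi (4 * c)) => // n f fb.
  apply: le_trans (phiP f n) _; rewrite ler_pM2r ?invr_gt0 ?expr2_gt0//.
  by rewrite ler_wpM2l// ler_piMr.
exists (MkGv phiG) => n; rewrite rnorm_GvE; apply: Gv_norm_le => f fb.
apply: le_trans (phiP f n) _; rewrite ler_pM2r ?invr_gt0 ?expr2_gt0//.
by rewrite ler_wpM2l// ler_piMr.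
Qed.

End GvComplete.

(** * Differentiability of the evaluation map into the predual *)

Section EvaluationDifferentiable.
Variables (R : realType) (E : normedModType R[i]) (U : set E) (v : weight U).
Local Notation C := (R[i]^o).
Local Notation H := (Hv v C).
Local Notation G := (Gv v).

Lemma valL0_val (F : normedModType R[i]) (f : U -> F) (w : U) : 'valL_0 f (val w) = f w.
Proof. by have := congr1 (@^~ w) (@valLK _ _ (0 : F) U f). Qed.

Lemma derivable_line (F : normedModType R[i]) (g : E -> F) (z u : E) (t : R[i]) :
  derivable g (z + t *: u) u ->
  is_derive (t : C) (1 : C) (fun t : C => g (z + t *: u)) ('D_u g (z + t *: u)).
Proof.
move=> dg; have Eq : (fun h : R[i] =>
    h^-1 *: (((fun t : C => g (z + t *: u)) \o shift t) (h *: (1 : C)) - g (z + t *: u)))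
    = (fun h : R[i] => h^-1 *: ((g \o shift (z + t *: u)) (h *: u) - g (z + t *: u))).
  by apply/funext => h /=; rewrite [h *: 1]mulr1 scalerDl addrCA.
by apply: DeriveDef; rewrite ?/derivable ?/derive Eq.
Qed.

Hypothesis U_open : open U.

Lemma weight_ball (z : U) : exists2 rho, 0 < rho & forall x : E,
  rnorm (x - val z) <= rho -> exists2 w : U, val w = x & v z / 2 <= v w.
Proof.
have vz := weight_gt0 v z; have vz2 : 0 < v z / 2 by rewrite divr_gt0.
have /cvgrPdist_le/(_ _ vz2) := @weight_continuous _ _ _ v z.
rewrite -nbhs_nearE nbhsE => -[_ [[W oW <-] Wz] WP].
have : nbhs (val z) (W `&` U).
  by apply: open_nbhs_nbhs; split; [exact: openI|split=> //; exact: set_valP].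
move=> /nbhs_ballP[e /= e0 eP].
have er : e = (complex.Re e)%:C by rewrite RRe_real ?gtr0_real.
have e0' : 0 < complex.Re e by rewrite -ltcR -er.
exists (complex.Re e / 2); first by rewrite divr_gt0.
move=> x xz; have [|Wx Ux] := eP x.
  by rewrite -ball_normE/= -rnormE er ltcR rnormB; lra.
exists (SigSub (mem_set Ux)) => //.
have := WP (SigSub (mem_set Ux)) Wx; rewrite /= ler_norml => /andP[_]; lra.
Qed.

Lemma valL0_lin (a : R[i]) (f g : H) :
  'valL_0 (a *: f + g : H) = a *: ('valL_0 f : E -> C) + 'valL_0 g.
Proof.
apply/funext => x; rewrite /valL_ /= !fctE /=.
by case: ('oinv_ _ _) => [y|]//=; rewrite scaler0 addr0.
Qed.

Lemma Hv_differentiable (F : normedModType R[i]) (f : Hv v F) (w : U) :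
  differentiable ('valL_0 f : E -> F) (val w).
Proof. by case: f => f /= /set_mem[hf _]; exact: hf. Qed.

Lemma Hv_ball_bound (F : normedModType R[i]) (f : Hv v F) (z w : U) :
  unit_ball f -> v z / 2 <= v w -> rnorm (f w) <= 2 / v z.
Proof.
move=> fb zw; have vz := weight_gt0 v z; rewrite -(ler_pM2l (weight_gt0 v w)).
apply: le_trans (le_trans (Hv_norm_ub f w) fb) _.
by rewrite mulrA ler_pdivlMr// mul1r -ler_pdivrMr.
Qed.

(** [taylor1] is applied on the complex line through [val z] in direction [u]. The radius is a
    quarter of that of [weight_ball], so that parameters of modulus up to 4 stay where [2 / v z]
    bounds the whole unit ball; hence the constants do not depend on [f]. *)
Lemma scalar_taylor (z : U) : exists rho M : R, [/\ 0 < rho, 0 < M,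
  (forall u : E, rnorm u <= rho -> exists w : U, val w = val z + u) &
  forall (f : H) (u : E) (s : R[i]) (w : U), unit_ball f -> rnorm u <= rho -> cabs s <= 1 ->
    val w = val z + s *: u -> rnorm (f w) <= M /\
    cabs (f w - f z - s * 'd ('valL_0 f : E -> C) (val z) u) <= 32 * M * cabs s ^+ 2].
Proof.
have [rho0 rho00 wP] := weight_ball z; have vz := weight_gt0 v z.
have M0 : 0 < 2 / v z by rewrite divr_gt0.
exists (rho0 / 4), (2 / v z); split=> //; first by rewrite divr_gt0.
  move=> u ur; have [|w <- _] := wP (val z + u); last by exists w.
  by rewrite addrAC subrr add0r; lra.
move=> f u s w fb ur s1 wE.
pose g : E -> C := 'valL_0 f; pose L (t : C) : C := g (val z + t *: u).
have pt t : cabs t <= 4 -> exists2 w : U, val w = val z + t *: u & v z / 2 <= v w.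
  move=> t4; apply: wP; rewrite addrAC subrr add0r rnormZ.
  apply: (@le_trans _ _ (4 * (rho0 / 4))); last by lra.
  by rewrite ler_pM ?rnorm_ge0.
have Lw t (w' : U) : val w' = val z + t *: u -> L t = f w'.
  by move=> wE'; rewrite /L -wE' /g valL0_val.
have dL t : cabs t <= 4 -> is_derive (t : C) (1 : C) L ('d g (val z + t *: u) u).
  move=> /pt[w' wE' _]; have dg : differentiable g (val z + t *: u).
    by rewrite -wE'; exact: Hv_differentiable.
  have dgu : derivable g (val z + t *: u) u by exact: diff_derivable.
  by have := derivable_line dgu; rewrite (deriveE u dg).
have bL t : cabs t <= 4 -> cabs (L t) <= 2 / v z.
  by move=> /pt[w' wE' vw]; rewrite (Lw _ _ wE'); exact: Hv_ball_bound.
have s4 : cabs s <= 4 by lra.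
split; first by rewrite -(Lw s)//; exact: bL.
have z0 : cabs (0 : R[i]) <= 4 by rewrite /cabs rnorm0.
have := @taylor1 R L (2 / v z) (ltW M0) _ bL s s1.
have -> : 'D_1 L 0 = 'd g (val z) u by have [_ ->] := dL 0 z0; rewrite scale0r addr0.
rewrite (Lw s _ wE) (Lw 0 z); last by rewrite scale0r addr0.
rewrite [_ * s]mulrC; apply.
by move=> t t4; have [] := dL t t4.
Qed.

Lemma diff_comb (F : normedModType R[i]) (f g : E -> F) (a : R[i]) (x h : E) :
  differentiable f x -> differentiable g x ->
  'd (a *: f + g) x h = a *: 'd f x h + 'd g x h.
Proof.
move=> df dg; have dZ := differentiableZ a df.
have e1 := congr1 (@^~ h) (diffD dZ dg); have e2 := congr1 (@^~ h) (diffZ a df).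
exact: (etrans e1 (congr1 (fun y => y + 'd g x h) e2)).
Qed.

Lemma evaluation_taylor (z : U) : exists (rho K : R) (D : {linear E -> G}), [/\ 0 < rho, 0 <= K,
  (forall h, rnorm (D h) <= K * rnorm h) &
  forall h (w : U), rnorm h <= rho -> val w = val z + h ->
    rnorm (evaluation v w - evaluation v z - D h) <= K * rnorm h ^+ 2].
Proof.
have [rho [M [rho0 M0 pt tay]]] := scalar_taylor z.
pose D h (f : H) : C := 'd ('valL_0 f : E -> C) (val z) h.
have Dlin h : linear (D h).
  move=> a f g; rewrite /D valL0_lin.
  exact: diff_comb (Hv_differentiable f z) (Hv_differentiable g z).
have Dlinh f : linear (D^~ f) by move=> a h k; rewrite /D linearP.
have nz (h : E) : h != 0 -> 0 < rnorm h.
  by move=> h0; rewrite lt_neqAle rnorm_ge0 andbT eq_sym; apply/eqP => /rnorm0_eq0; exact/eqP.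
have cR (x : R) : 0 <= x -> rnorm (x%:C : C) = x.
  by move=> x0; rewrite -/(cabs _) cabs_real ger0_norm.
have DZ f (a : R[i]) h : D (a *: h) f = a *: D h f by rewrite /D linearZ.
(* For [u] of norm [rho], the Taylor bound at [s = 1] gives [M + M + 32 * M]; the rest is
   scaling. *)
have Dle h f : unit_ball f -> rnorm (D h f) <= 34 * M / rho * rnorm h.
  move=> fb; have [->|h0] := eqVneq h 0; first by rewrite /D linear0 !rnorm0 mulr0.
  have hn := nz _ h0; have a0 : 0 < rho / rnorm h by rewrite divr_gt0.
  pose u := (rho / rnorm h)%:C *: h.
  have ur : rnorm u = rho by rewrite rnormZ cR ?ltW// divfK// gt_eqF.
  have ur' : rnorm u <= rho by rewrite ur.
  have [w wE] := pt u ur'.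
  have one : cabs (1 : R[i]) = 1 by have := cabs_real (1 : R); rewrite normr1.
  have one' : cabs (1 : R[i]) <= 1 by rewrite one.
  have [|fw] := tay f u 1 w fb ur' one'; first by rewrite scale1r.
  have zero' : cabs (0 : R[i]) <= 1 by rewrite /cabs rnorm0.
  have [|fz _] := tay f u 0 z fb ur' zero'; first by rewrite scale0r addr0.
  rewrite mul1r one expr1n mulr1 -/(D u f) => le.
  have : rnorm (D u f) <= 34 * M.
    have := ler_rnormB (D u f) (f w - f z) 0; rewrite !subr0 rnormB.
    have := ler_rnormD (f w : C) (- f z); rewrite rnormN.
    by rewrite /cabs in le; lra.
  rewrite /u DZ rnormZ cR; last exact: ltW.
  rewrite -ler_pdivlMl// => /le_trans; apply.
  by rewrite invf_div mulrC mulrA mulrAC.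
(* The directional derivative is the limit of difference quotients at the parameters [1 / 2 ^ n],
   with a rate uniform on the ball. Dividing [h] by [a] brings it within [rho], also when
   [h = 0]. *)
have DG h : D h \in @Gv_pred _ _ _ v.
  pose a := rnorm h / rho + 1.
  have a0 : 0 < a by rewrite ltr_wpDl// divr_ge0 ?rnorm_ge0// ltW.
  pose u := a^-1%:C *: h.
  have ur : rnorm u <= rho.
    rewrite rnormZ cR; last by rewrite invr_ge0 ltW.
    by rewrite ler_pdivrMl// mulrDl mul1r divfK ?gt_eqF// lerDl ltW.
  pose s n : R[i] := (2 ^+ n)^-1%:C.
  have p0 n : 0 < 2 ^+ n :> R := expr2_gt0 R n.
  have cs n : cabs (s n) = (2 ^+ n)^-1 by rewrite /cabs cR ?invr_ge0 ?ltW.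
  have s1 n : cabs (s n) <= 1 by rewrite cs invf_le1// exprn_ege1// ler1n.
  have /choice[w wE] n : exists w : U, val w = val z + s n *: u.
    by apply: pt; rewrite rnormZ; apply: le_trans ur; rewrite ler_piMl ?rnorm_ge0//; exact: s1.
  apply: (@Gv_unif_limit _ _ _ _
    (fun n => (a * 2 ^+ n)%:C *: (evaluation v (w n) - evaluation v z)) _ (32 * a * M)) => //.
  move=> n f fb; have [_ le] := tay f u (s n) (w n) fb ur (s1 n) (wE n).
  have -> : ((a * 2 ^+ n)%:C *: (evaluation v (w n) - evaluation v z)) f - D h f =
      (a * 2 ^+ n)%:C *: (f (w n) - f z - s n * D u f : C).
    have -> : ((a * 2 ^+ n)%:C *: (evaluation v (w n) - evaluation v z)) f =
      (a * 2 ^+ n)%:C *: (f (w n) - f z : C) by [].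
    rewrite [RHS]scalerBr; congr (_ - _); rewrite /u DZ [RHS]mulrA [RHS]mulrA.
    rewrite /s -!rmorphM/= [X in X%:C](_ : _ = 1) ?mul1r//.
    by field; rewrite !gt_eqF//=.
  rewrite rnormZ cR; last by rewrite mulr_ge0// ltW.
  apply: (@le_trans _ _ (a * 2 ^+ n * (32 * M * cabs (s n) ^+ 2))).
    by rewrite ler_pM2l// mulr_gt0.
  rewrite cs le_eqVlt; apply/orP; left; apply/eqP.
  by field; rewrite gt_eqF.
pose DD h : G := MkGv (DG h).
have DDlin : linear DD.
  by move=> a h k; apply/val_inj/funext => f; rewrite /= [LHS]Dlinh.
pose isL := GRing.isLinear.Build _ _ _ _ DD DDlin.
pose DL : {linear E -> G} := HB.pack DD isL.
have K1 : 0 <= 34 * M / rho by rewrite divr_ge0 ?mulr_ge0// ltW.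
have K2 : 0 <= 32 * M / rho ^+ 2 by rewrite divr_ge0 ?mulr_ge0 ?sqr_ge0// ltW.
exists rho, (34 * M / rho + 32 * M / rho ^+ 2), DL; split=> //.
- by rewrite addr_ge0.
- move=> h; rewrite rnorm_GvE; apply: Gv_norm_le => f fb.
  apply: le_trans (Dle h f fb) _; rewrite ler_wpM2r ?rnorm_ge0// lerDl//.
- move=> h w hr wE; rewrite rnorm_GvE; apply: Gv_norm_le => f fb.
  have -> : (evaluation v w - evaluation v z - DL h) f = f w - f z - D h f by [].
  apply: (@le_trans _ _ (32 * M / rho ^+ 2 * rnorm h ^+ 2)); last first.
    by rewrite ler_wpM2r ?sqr_ge0// lerDr.
  have [h0|h0] := eqVneq h 0.
    have -> : w = z by apply: val_inj; rewrite wE h0 addr0.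
    by rewrite h0 /D linear0 subrr subr0 !rnorm0 expr0n mulr0.
  (* Writing [h = s u] with [u] of norm [rho] turns the square of [s] into
     [rnorm h ^+ 2 / rho ^+ 2]. *)
  have hn := nz _ h0; pose u := (rho / rnorm h)%:C *: h.
  have ur : rnorm u <= rho.
    by rewrite rnormZ cR; [rewrite divfK ?gt_eqF|rewrite divr_ge0 ?ltW].
  pose s : R[i] := (rnorm h / rho)%:C.
  have su : s *: u = h.
    rewrite scalerA -rmorphM/= [X in X%:C](_ : _ = 1) ?scale1r//.
    by field; rewrite !gt_eqF.
  have cs : cabs s = rnorm h / rho by rewrite /cabs cR// divr_ge0 ?ltW.
  have [||_] := tay f u s w fb ur.
  + by rewrite cs ler_pdivrMr// mul1r.
  + by rewrite su.
  rewrite -/(D u f) -[s * _]/(s *: _) -DZ su cs => le; apply: le_trans le _.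
  by rewrite expr_div_n mulrA mulrAC.
Qed.

End EvaluationDifferentiable.

(** * Bounded operators on the predual as weighted holomorphic mappings *)

Section Operators.
Variables (R : realType).

Lemma rnorm_continuous (X Y : normedModType R[i]) (T : {linear X -> Y}) (B : R) :
  (forall x, rnorm (T x) <= B * rnorm x) -> continuous T.
Proof.
move=> TB x; apply/cvgrPdist_le => e e0.
have er : e = (complex.Re e)%:C by rewrite RRe_real ?gtr0_real.
have e0' : 0 < complex.Re e by rewrite -ltcR -er.
have B1 : 0 < `|B| + 1 by rewrite ltr_wpDl.
have d0 : 0 < (complex.Re e / (`|B| + 1))%:C :> R[i] by rewrite ltcR divr_gt0.
near=> y; have : `|x - y| <= (complex.Re e / (`|B| + 1))%:C.
  by near: y; apply: cvgr_dist_le d0; exact: cvg_id.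
rewrite -rnormE lecR ler_pdivlMr// => le.
rewrite -linearB -rnormE er lecR; apply: le_trans (TB _) (le_trans _ le).
rewrite mulrC ler_wpM2l ?rnorm_ge0//; apply: le_trans (ler_norm _) _.
by rewrite lerDl.
Unshelve. all: by end_near. Qed.

Lemma dual_sphere_le (X : normedModType R[i]) (phi : {linear X -> R[i]^o}) x :
  dual_sphere phi -> rnorm (phi x) <= rnorm x.
Proof.
move=> [_ phi1]; have phib y : rnorm y <= 1 -> rnorm (phi y) <= 1.
  move=> y1; rewrite -phi1; apply: ub_le_sup; last by exists y.
  (* [sup] of an unbounded set is 0 by convention, so a dual norm equal to 1 forces boundedness on
     the ball. *)
  apply: contrapT => nb; move: phi1; rewrite /dual_norm sup_out; last by case.
  by move/esym/eqP; rewrite oner_eq0.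
have [->|x0] := eqVneq x 0; first by rewrite linear0 !rnorm0.
have nx : 0 < rnorm x.
  by rewrite lt_neqAle rnorm_ge0 andbT eq_sym; apply/eqP => /rnorm0_eq0; exact/eqP.
have nc : rnorm ((rnorm x)^-1%:C : R[i]^o) = (rnorm x)^-1.
  by rewrite -/(cabs _) cabs_real gtr0_norm ?invr_gt0.
have := phib ((rnorm x)^-1%:C *: x); rewrite linearZ !rnormZ nc mulVf ?gt_eqF//.
by move=> /(_ (lexx _)); rewrite ler_pdivrMl// mulr1.
Qed.

Variables (E : normedModType R[i]) (U : set E) (v : weight U).
Hypothesis U_open : open U.
Variable F : normedModType R[i].
Local Notation G := (Gv v).

Definition atom (l : R[i]) (z : U) : G := l *: ((v z)%:C *: evaluation v z).

Lemma cabs_weight z : cabs (v z)%:C = v z.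
Proof. by rewrite cabs_real gtr0_norm// weight_gt0. Qed.

Lemma atom_le1 l z : cabs l = 1 -> rnorm (atom l z) <= 1.
Proof.
move=> l1; rewrite rnorm_GvE; apply: Gv_norm_le => f fb.
have -> : atom l z f = l *: ((v z)%:C *: f z) by [].
rewrite !rnormZ -!/(cabs _) l1 mul1r cabs_weight.
exact: le_trans (Hv_norm_ub f z) fb.
Qed.

(** The differential is [T] composed with that of the evaluation map: [T] sends its quadratic
    remainder to one of size at most [|B| * K * rnorm h ^+ 2]. *)
Lemma Hv_operator (T : {linear G -> F}) (B : R) :
  (forall x, rnorm (T x) <= B * rnorm x) ->
  (fun z => T (evaluation v z)) \in @Hv_pred _ _ _ v F.
Proof.
move=> TB.
apply/mem_set; split; last first.
  exists `|B| => _ [z _ <-]; have -> : v z * rnorm (T (evaluation v z)) = rnorm (T (atom 1 z)).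
    by rewrite /atom scale1r linearZ rnormZ -/(cabs _) cabs_weight.
  apply: le_trans (TB _) _; apply: le_trans (ler_wpM2r (rnorm_ge0 _) (ler_norm B)) _.
  rewrite ler_piMr// atom_le1//.
  by have := cabs_real (1 : R); rewrite normr1.
move=> z; set g : E -> F := 'valL_0 _.
have [rho [K [D [rho0 K0 DK tay]]]] := evaluation_taylor v U_open z.
have [rho' rho'0 wP] := weight_ball v U_open z.
pose df : {linear E -> F} := T \o D.
have dfc : continuous df.
  apply: (@rnorm_continuous _ _ df (`|B| * K)) => h.
  apply: le_trans (TB _) _; apply: le_trans (ler_wpM2r (rnorm_ge0 _) (ler_norm B)) _.
  by rewrite -mulrA ler_wpM2l.
have gE : g \o shift (val z) = cst (g (val z)) + df +o_ 0 id.
  apply/eqaddoP => e e0.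
  have er : e = (complex.Re e)%:C by rewrite RRe_real ?gtr0_real.
  have e0' : 0 < complex.Re e by rewrite -ltcR -er.
  have BK1 : 0 < `|B| * K + 1 by rewrite ltr_wpDl// mulr_ge0.
  pose d := Num.min (Num.min rho rho') (complex.Re e / (`|B| * K + 1)).
  have d0 : 0 < d%:C :> R[i] by rewrite ltcR !lt_min rho0 rho'0 divr_gt0.
  near=> h; have : `|0 - h| <= d%:C.
    by near: h; apply: cvgr_dist_le d0; exact: cvg_id.
  rewrite sub0r normrN -rnormE lecR !le_min => /andP[/andP[hr hr'] he].
  have [|w wE _] := wP (h + val z); first by rewrite addrK.
  have -> : (g \o shift (val z) - (cst (g (val z)) + df)) h =
      T (evaluation v w - evaluation v z - D h).
    rewrite -[LHS]/(g (h + val z) - (g (val z) + T (D h))) -wE /g !valL0_val.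
    by rewrite !linearB opprD addrA.
  rewrite -!rnormE er -rmorphM/= lecR.
  apply: le_trans (TB _) _; apply: le_trans (ler_wpM2r (rnorm_ge0 _) (ler_norm B)) _.
  apply: le_trans (ler_wpM2l (normr_ge0 B) (tay _ _ hr _)) _; first by rewrite wE addrC.
  rewrite mulrA expr2 mulrA ler_wpM2r ?rnorm_ge0//.
  move: he; rewrite ler_pdivlMr//; apply: le_trans.
  by rewrite mulrC ler_wpM2l ?rnorm_ge0// lerDl.
have dE := diff_unique dfc gE.
by apply/diff_locallyP; rewrite dE.
Unshelve. all: by end_near. Qed.

Lemma linear_comp_Hv (Psi : {linear F -> R[i]^o}) (f : Hv v F) (B : R) :
  (forall y, rnorm (Psi y) <= B * rnorm y) ->
  (fun z => Psi (f z)) \in @Hv_pred _ _ _ v (R[i]^o).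
Proof.
move=> PB; apply/mem_set; split; last first.
  have [M fM] := Hv_has_ubound f.
  exists (`|B| * M) => _ [z _ <-].
  apply: (@le_trans _ _ (`|B| * (v z * rnorm (f z)))).
    rewrite mulrCA ler_wpM2l ?(ltW (weight_gt0 v z))//; apply: le_trans (PB _) _.
    by rewrite ler_wpM2r ?rnorm_ge0 ?ler_norm.
  by rewrite ler_wpM2l//; apply: fM; exists z.
move=> z; have Pc := rnorm_continuous PB.
have -> : 'valL_0 (fun z => Psi (f z)) = Psi \o ('valL_0 f : E -> F).
  by apply/funext => x; rewrite /valL_ /=; case: ('oinv_ _ _) => //=; rewrite linear0.
by apply: differentiable_comp; [exact: Hv_differentiable|exact: linear_differentiable].
Qed.

(* A norming functional reduces the estimate to the action of atoms on scalar functions;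
   the factor 2 comes from the crude bound in [norming_functional]. *)
Lemma atom_lipschitz (f : Hv v F) (B : R) l1 z1 l2 z2 :
  (forall w, v w * rnorm (f w) <= B) ->
  rnorm (l1 *: ((v z1)%:C *: f z1) - l2 *: ((v z2)%:C *: f z2)) <=
    2 * B * rnorm (atom l1 z1 - atom l2 z2).
Proof.
move=> fB; set y := _ - _; have [Psi [yP PB]] := norming_functional y.
have B0 : 0 <= B.
  by apply: le_trans (fB z1); rewrite mulr_ge0 ?rnorm_ge0// ltW// weight_gt0.
pose h : Hv v (R[i]^o) := MkHv (linear_comp_Hv f PB).
have hn : rnorm h <= 2 * B.
  rewrite rnorm_HvE; apply: Hv_norm_le; first by rewrite mulr_ge0.
  move=> w; apply: (@le_trans _ _ (2 * (v w * rnorm (f w)))).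
    by rewrite mulrCA ler_wpM2l ?PB// ltW// weight_gt0.
  by rewrite ler_wpM2l.
apply: le_trans yP _; have -> : Psi y = (atom l1 z1 - atom l2 z2) h.
  rewrite -[RHS]/(l1 *: ((v z1)%:C *: Psi (f z1)) - l2 *: ((v z2)%:C *: Psi (f z2))).
  have PZ (a : R[i]) x : Psi (a *: x) = a *: Psi x :> R[i]^o by exact: linearZ.
  by rewrite /y linearB !PZ.
apply: le_trans (Gv_app_le _ _) _; rewrite mulrC ler_wpM2r ?rnorm_ge0//.
Qed.

End Operators.

(** * One perturbation step *)

Section Step.
Variables (R : realType) (E : normedModType R[i]) (U : set E) (v : weight U).
Variable F : normedModType R[i].
Local Notation G := (Gv v).

(** A stage of the iteration is the pair of the fixed [f] and an operator [T], so its values are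
    available before the sum is made an element of [Hv]. *)
Definition weighted (f : Hv v F) (T : G -> F) (z : U) : R :=
  v z * rnorm (f z + T (evaluation v z)).

Lemma phase_exists (c : R[i]) : exists2 l : R[i], cabs l = 1 & l * c = (cabs c)%:C.
Proof.
have [->|c0] := eqVneq c 0.
  exists 1; first by have := cabs_real (1 : R); rewrite normr1.
  by rewrite mulr0 /cabs rnorm0.
exists (`|c| / c); last by rewrite divfK// cabsE.
by apply: complexI; rewrite cabsE normrM normfV normr_id divff// normr_eq0.
Qed.

Lemma weight_rnorm (X : normedModType R[i]) (z : U) (l : R[i]) (x : X) :
  cabs l = 1 -> rnorm (l *: ((v z)%:C *: x)) = v z * rnorm x.
Proof.
move=> l1; have l1' : rnorm (l : R[i]^o) = 1 := l1.
have vz : rnorm ((v z)%:C : R[i]^o) = v z := cabs_weight v z.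
by rewrite !rnormZ l1' vz mul1r.
Qed.

Lemma weight_operator_le (T : {linear G -> F}) (B : R) (z : U) :
  0 <= B -> (forall x, rnorm (T x) <= B * rnorm x) -> v z * rnorm (T (evaluation v z)) <= B.
Proof.
move=> B0 TB; have c1 : cabs (1 : R[i]) = 1 by have := cabs_real (1 : R); rewrite normr1.
have -> : v z * rnorm (T (evaluation v z)) = rnorm (T (atom v 1 z)).
  by rewrite /atom scale1r linearZ rnormZ -/(cabs _) cabs_weight.
by apply: le_trans (TB _) _; rewrite ler_piMr// atom_le1.
Qed.

(* The rank-one perturbation [T' = T + kappa phi y], with [y] the value at the atom of
   [z], increases the norm near that atom only, so almost norming points of [f + T'] lie in
   a slice of [phi] once the phase is adjusted. *)
Lemma bpb_step (f : Hv v F) (T : {linear G -> F}) (phi : {linear G -> R[i]^o})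
    (l : R[i]) (z : U) (kappa sigma sigma' delta : R) :
  cabs l = 1 -> dual_sphere phi -> phi (atom v l z) = 1 ->
  (forall w, weighted f T w <= weighted f T z + sigma) -> 2^-1 <= weighted f T z ->
  0 < kappa -> 0 < sigma' -> 2 * (sigma + sigma') < kappa * delta ->
  exists (T' : {linear G -> F}) (l' : R[i]) (z' : U), [/\ cabs l' = 1,
    forall x, rnorm (T' x - T x) <= kappa * weighted f T z * rnorm x,
    forall w, weighted f T' w <= weighted f T' z' + sigma' &
    slice phi delta (atom v l' z')].
Proof.
move=> l1 phi1 phiz near_sup N2 k0 s0 small; set N : R := weighted f T z in near_sup N2 *.
have N0 : 0 <= N by lra.
have [y yE] : exists y : F, y = l *: ((v z)%:C *: (f z + T (evaluation v z))) by eexists.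
have yN : rnorm y = N by rewrite yE weight_rnorm.
have kC : rnorm (kappa%:C : R[i]^o) = kappa by have := cabs_real kappa; rewrite gtr0_norm.
pose T'f x : F := T x + (kappa%:C * phi x) *: y.
have T'lin : linear T'f.
  move=> a x1 x2; rewrite /T'f [T _]linearP [phi _]linearP.
  have -> : (kappa%:C * (a *: phi x1 + phi x2)) *: y =
      a *: ((kappa%:C * phi x1) *: y) + (kappa%:C * phi x2) *: y.
    by rewrite scalerA -scalerDl; congr (_ *: _); rewrite /GRing.scale/=; ring.
  by rewrite scalerDr addrACA.
pose isL := GRing.isLinear.Build _ _ _ _ T'f T'lin.
pose T' : {linear G -> F} := HB.pack T'f isL.
have T'E x : T' x = T x + (kappa%:C * phi x) *: y by [].
have T'T x : rnorm (T' x - T x) = kappa * N * rnorm (phi x).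
  rewrite T'E addrAC subrr add0r rnormZ yN.
  have := rnormZ kappa%:C (phi x); rewrite kC => ->.
  by rewrite mulrAC.
have wT' w : weighted f T' w <=
    weighted f T w + kappa * N * cabs (phi ((v w)%:C *: evaluation v w)).
  have E1 : v w * rnorm (T' (evaluation v w) - T (evaluation v w)) =
      kappa * N * cabs (phi ((v w)%:C *: evaluation v w)).
    rewrite T'T mulrCA; congr (_ * _); rewrite linearZ_LR [RHS]rnormZ.
    by congr (_ * _); rewrite -[LHS](cabs_weight v w).
  rewrite -E1 /weighted -mulrDr ler_pM2l ?weight_gt0//.
  have -> : f w + T' (evaluation v w) = (f w + T (evaluation v w)) +
      (T' (evaluation v w) - T (evaluation v w)) by rewrite -addrA subrKC.
  exact: ler_rnormD.
have c1 : cabs (1 : R[i]) = 1 by have := cabs_real (1 : R); rewrite normr1.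
have phile w : cabs (phi ((v w)%:C *: evaluation v w)) <= 1.
  apply: le_trans (dual_sphere_le _ phi1) _.
  by have := atom_le1 v w c1; rewrite /atom scale1r.
have kN : 0 <= kappa * N by rewrite mulr_ge0// ltW.
have bd : has_sup (range (weighted f T')).
  split; first by exists (weighted f T' z), z.
  exists (N + sigma + kappa * N) => _ [w _ <-]; apply: le_trans (wT' w) _.
  by rewrite lerD// ler_piMr.
have [_ [z' _ <-] z'P] := sup_adherent s0 bd.
have nsup w : weighted f T' w <= weighted f T' z' + sigma'.
  rewrite -lerBlDr; apply: le_trans _ (ltW z'P); rewrite lerD2r.
  by apply: ub_le_sup; [exact: bd.2|exists w].
(* This phase makes [phi] real and nonnegative at the new atom, so that the slice condition concerns
   the modulus only. *)
have [l' l'1 l'c] := phase_exists (phi ((v z')%:C *: evaluation v z')).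
exists T', l', z'; split=> //.
  by move=> x; rewrite T'T ler_wpM2l// dual_sphere_le.
split; first exact: atom_le1.
have -> : phi (atom v l' z') = (cabs (phi ((v z')%:C *: evaluation v z')))%:C.
  by rewrite -l'c /atom linearZ_LR.
have pz : l * ((v z)%:C * (phi (evaluation v z) : R[i])) = 1.
  by have := phiz; rewrite /atom linearZ_LR linearZ_LR.
(* At the old atom [phi] equals 1 and the correction is [kappa] times the value [y] itself, so the
   norms add exactly. *)
have Nz : weighted f T' z = (1 + kappa) * N.
  rewrite /weighted -(weight_rnorm z _ l1) T'E addrA [in LHS]scalerDr [in LHS]scalerDr -yE.
  have -> : l *: ((v z)%:C *: ((kappa%:C * phi (evaluation v z)) *: y)) = kappa%:C *: y.
    rewrite [X in l *: X]scalerA [LHS]scalerA; congr (_ *: _).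
    by rewrite -[RHS]mulr1 -pz; move: (phi _ : R[i]) => p; ring.
  rewrite -[X in X + _]scale1r -scalerDl rnormZ yN; congr (_ * _).
  have := cabs_real (1 + kappa); rewrite rmorphD/= ger0_norm//.
  by rewrite addr_ge0// ltW.
(* Together these give [(1 + kappa) N <= N + sigma + kappa N c + sigma']. If [c <= 1 - delta], then
   [N >= 1/2] yields [kappa * delta <= 2 * (sigma + sigma')], against the choice of tolerances. *)
have := nsup z; rewrite Nz; have := wT' z'; have := near_sup z'.
set c := cabs _ => h1 h2 h3; rewrite /= ltNge; apply/negP => h4.
have h5 : kappa * N * (1 - c) <= sigma + sigma' by lra.
have h6 : delta <= 1 - c by lra.
have h7 : kappa * N * delta <= kappa * N * (1 - c) by rewrite ler_wpM2l.
have h8 : 0 < delta.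
  rewrite ltNge; apply/negP => d0.
  have : kappa * delta <= 0 by rewrite mulr_ge0_le0// ltW.
  have : 0 <= kappa * N * (1 - c) by rewrite mulr_ge0// subr_ge0 /c phile.
  by lra.
have h9 : 0 < kappa * delta by rewrite mulr_gt0.
by nra.
Qed.

End Step.

(** * The iteration and its limit *)

Section Iteration.
Variables (R : realType) (E : normedModType R[i]) (U : set E) (v : weight U).
Local Notation G := (Gv v).

Lemma circle_atomsP (x : G) :
  circle_atoms v x <-> exists l z, cabs l = 1 /\ x = atom v l z.
Proof.
split=> [[l l1 [_ [z _ <-] <-]]|[l [z [l1 ->]]]].
  by exists l, z; split=> //; apply: complexI; rewrite cabsE.
exists l; first by rewrite /unit_circle/= -cabsE l1.
by exists ((v z)%:C *: evaluation v z) => //; exists z.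
Qed.

(** The exposed atom lies in its own slice, so the diameter bounds the distance from it to any other
    point there. *)
Lemma exposed_atoms_modulus (phi : G -> {linear G -> R[i]^o}) (eps delta : R) :
  (forall x, circle_atoms v x -> dual_sphere (phi x) /\ phi x x = 1) ->
  0 < delta ->
  (forall x, circle_atoms v x -> (diam (slice (phi x) delta) < eps%:E)%E) ->
  forall l z x, cabs l = 1 -> slice (phi (atom v l z)) delta x ->
    rnorm (x - atom v l z) < eps.
Proof.
move=> phiP d0 diamP l z x l1 xs.
have ax : circle_atoms v (atom v l z) by apply/circle_atomsP; exists l, z.
have [_ phi1] := phiP _ ax.
rewrite -lte_fin; apply: le_lt_trans (diamP _ ax); apply: ereal_sup_ubound.
exists (x, atom v l z) => //; split=> //=; split; first exact: atom_le1.
by rewrite phi1/= gtrBl.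
Qed.

Variables (F : completeNormedModType R[i]) (f : Hv v F).
Variable phi : G -> {linear G -> R[i]^o}.
Variables (eps : R) (dl : nat -> R).
Hypothesis eps01 : 0 < eps < 1.
Hypothesis phiP : forall x, circle_atoms v x -> dual_sphere (phi x) /\ phi x x = 1.
Hypothesis dl01 : forall n, 0 < dl n < 1.

(** This is both the coefficient of the n-th rank-one correction and the bound on the n-th
    displacement of the atom. *)
Let kap n : R := eps / 2 ^+ (n + 4).
Hypothesis modulus : forall n l z x, cabs l = 1 ->
  slice (phi (atom v l z)) (dl n) x -> rnorm (x - atom v l z) < kap n.

Let rh n : R := kap n * dl n / 8.
(* Chosen so that twice the sum of two consecutive tolerances stays below
   [kap n * dl n], as [bpb_step] requires. *)
Definition tolerance n : R := if n is m.+1 then Num.min (rh m) (rh n) else rh 0%N.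

Let kap0 n : 0 < kap n.
Proof. by case/andP: eps01 => e0 _; rewrite divr_gt0// expr2_gt0. Qed.

Let kapE n : kap n = eps / 16 / 2 ^+ n.
Proof.
rewrite /kap exprD; have := expr2_gt0 R n; move: (2 ^+ n) => p p0.
by field; rewrite gt_eqF.
Qed.

Let rh0 n : 0 < rh n.
Proof. by case/andP: (dl01 n) => d0 _; rewrite divr_gt0// mulr_gt0. Qed.

Lemma tolerance_gt0 n : 0 < tolerance n.
Proof. by case: n => [|n] /=; rewrite ?lt_min !rh0. Qed.

Let tol1 n : tolerance n <= rh n.
Proof. by case: n => [|n]//=; rewrite ge_min lexx orbT. Qed.

Let tol2 n : tolerance n.+1 <= rh n.
Proof. by rewrite /= ge_min lexx. Qed.

Let pow_le1 n : 0 < (2 ^+ n : R)^-1 <= 1.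
Proof. by rewrite invr_gt0 expr2_gt0 invf_le1 ?expr2_gt0// exprn_ege1// ler1n. Qed.

Lemma tolerance_le n : tolerance n <= eps / 128 / 2 ^+ n.
Proof.
apply: le_trans (tol1 n) _; rewrite /rh kapE.
have /andP[d0 d1] := dl01 n; have /andP[e0 e1] := eps01; have /andP[p0 p1] := pow_le1 n.
have h : eps / 16 / 2 ^+ n * dl n <= eps / 16 / 2 ^+ n.
  by rewrite ler_piMr ?ltW// !divr_gt0// expr2_gt0.
apply: (@le_trans _ _ (eps / 16 / 2 ^+ n / 8)); first by rewrite ler_pM2r.
by rewrite le_eqVlt; apply/orP; left; apply/eqP; field; rewrite gt_eqF// expr2_gt0.
Qed.

Hypothesis f1 : rnorm f = 1.
Variables (l0 : R[i]) (z0 : U).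
Hypothesis l01 : cabs l0 = 1.
Hypothesis near0 : 1 - tolerance 0 < v z0 * rnorm (f z0).

(** A state holds the accumulated operator, a phase and a point. The operator bound is the sum of
    [eps / 8 / 2 ^ k] over [k < n]. *)
Let inv n (s : {linear G -> F} * R[i] * U) := [/\ cabs s.1.2 = 1,
  forall x, rnorm (s.1.1 x) <= eps / 4 * (1 - (2 ^+ n)^-1) * rnorm x &
  forall w, weighted f s.1.1 w <= weighted f s.1.1 s.2 + tolerance n].

Let rel n (s s' : {linear G -> F} * R[i] * U) :=
  (forall x, rnorm (s'.1.1 x - s.1.1 x) <= eps / 8 / 2 ^+ n * rnorm x) /\
  rnorm (atom v s'.1.2 s'.2 - atom v s.1.2 s.2) <= eps / 16 / 2 ^+ n.

Lemma weightedD_le (T T' : {linear G -> F}) (B : R) (z : U) : 0 <= B ->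
  (forall x, rnorm (T x - T' x) <= B * rnorm x) -> weighted f T z <= weighted f T' z + B.
Proof.
move=> B0 TB; have := @weight_operator_le _ _ _ v F (T \- T') B z B0 TB.
rewrite /= => le; apply: le_trans (lerD (lexx _) le).
rewrite /weighted -mulrDr ler_pM2l ?weight_gt0//.
have -> : f z + T (evaluation v z) = (f z + T' (evaluation v z)) +
    (T (evaluation v z) - T' (evaluation v z)) by rewrite -addrA subrKC.
exact: ler_rnormD.
Qed.

Let weighted0 z : weighted f (\0 : G -> F) z = v z * rnorm (f z).
Proof. by rewrite /weighted addr0. Qed.

Let weighted_f_le1 z : weighted f (\0 : G -> F) z <= 1.
Proof. by rewrite weighted0 -f1 rnorm_HvE Hv_norm_ub. Qed.

Lemma weighted_bounds (T : {linear G -> F}) (B : R) (z : U) : 0 <= B ->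
  (forall x, rnorm (T x) <= B * rnorm x) ->
  v z * rnorm (f z) - B <= weighted f T z <= 1 + B.
Proof.
move=> B0 TB; rewrite -weighted0.
have h1 : weighted f (\0 : G -> F) z <= weighted f T z + B.
  by apply: (@weightedD_le \0 T) => // x; rewrite /= sub0r rnormN.
have h2 : weighted f T z <= weighted f (\0 : G -> F) z + B.
  by apply: (@weightedD_le T \0) => // x; rewrite /= subr0.
by have w1 := weighted_f_le1 z; apply/andP; split; lra.
Qed.

Lemma bpb_iterates : exists u : nat -> {linear G -> F} * R[i] * U,
  u 0%N = ((\0 : {linear G -> F}), l0, z0) /\ forall n, inv n (u n) /\ rel n (u n) (u n.+1).
Proof.
have /andP[e0 e1] := eps01.
apply: dependent_choice_nat; first split=> //= [x|w].
- by rewrite rnorm0 expr0 invr1 subrr mulr0 mul0r.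
- apply: le_trans (weighted_f_le1 w) _; have := near0.
  by rewrite -weighted0 => /ltW; rewrite lerBlDr.
move=> n [[T l] z] [/= l1 TB near].
have /andP[p0 p1] := pow_le1 n.
pose B := eps / 4 * (1 - (2 ^+ n)^-1).
have B0 : 0 <= B by rewrite mulr_ge0 ?divr_ge0 ?subr_ge0// ltW.
have B4 : B <= 4^-1 by rewrite /B; nra.
have /andP[_ Nle] := @weighted_bounds T B z B0 TB.
have /andP[Nge0 _] := @weighted_bounds T B z0 B0 TB.
have tole m : tolerance m <= 8^-1.
  apply: le_trans (tolerance_le m) _; have /andP[q0 q1] := pow_le1 m; nra.
(* Comparison with the initial point: the value is at least 1 less 1/8 for the first tolerance, 1/4
   for [B] and 1/8 for the current tolerance. *)
have N2 : 2^-1 <= weighted f T z.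
  by have := near z0; have := near0; have := tole n; have := tole 0%N; lra.
have al : circle_atoms v (atom v l z) by apply/circle_atomsP; exists l, z.
have [ph1 ph2] := phiP al.
have sm : 2 * (tolerance n + tolerance n.+1) < kap n * dl n.
  have := tol1 n; have := tol2 n; have := rh0 n; rewrite /rh; lra.
have [T' [l' [z' [l'1 T'T near' sl]]]] :=
  bpb_step l1 ph1 ph2 near N2 (kap0 n) (tolerance_gt0 n.+1) sm.
have T'T2 x : rnorm (T' x - T x) <= eps / 8 / 2 ^+ n * rnorm x.
  apply: le_trans (T'T x) _; rewrite ler_wpM2r ?rnorm_ge0//.
  have -> : eps / 8 / 2 ^+ n = kap n * 2.
    by rewrite kapE; field; rewrite gt_eqF ?expr2_gt0.
  by rewrite ler_pM2l//; lra.
exists (T', l', z'); split; split=> //=.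
- move=> x; have := ler_rnormB (T' x) (T x) 0; rewrite !subr0.
  have := T'T2 x; have := TB x; rewrite exprS invfM.
  by have := rnorm_ge0 x; move: (rnorm x) (rnorm _) (rnorm _) (rnorm _) => a b c d; lra.
- by apply: ltW; rewrite -kapE; exact: modulus.
Qed.

Hypothesis closed_atoms : closed (circle_atoms v).

(** At stage n the point [(u n).2] is almost norming; replacing [T n] by its limit and the n-th atom
    by the limit atom changes values by a multiple of [eps / 2 ^ n], which vanishes. The mapping [g]
    is a parameter, so its membership in [Hv] is supplied separately. *)
Lemma bpb_limit : exists (T : {linear G -> F}) (l : R[i]) (z : U), [/\ cabs l = 1,
  forall x, rnorm (T x) <= 3 / 8 * eps * rnorm x,
  rnorm (atom v l0 z0 - atom v l z) < eps &
  forall (g : Hv v F), (forall w, g w = f w + T (evaluation v w)) ->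
    forall w, v w * rnorm (g w) <= v z * rnorm (g z)].
Proof.
have /andP[e0 e1] := eps01.
have [u [u0 uP]] := bpb_iterates.
pose T n := (u n).1.1; pose x n := atom v (u n).1.2 (u n).2.
have /choice[Tf TfP] a : exists y, forall n, rnorm (T n a - y) <= eps / 2 / 2 ^+ n * rnorm a.
  have [|y yP] := @complete_geo_complete R F (T ^~ a) (eps / 8 * rnorm a).
    by move=> n; have [_ [+ _]] := uP n => /(_ a); rewrite mulrAC.
  exists y => n; apply: le_trans (yP n) _; rewrite le_eqVlt; apply/orP; left; apply/eqP.
  by field; rewrite gt_eqF// expr2_gt0.
have Tlin : linear Tf.
  move=> a y1 y2; apply/eqP; rewrite -subr_eq0; apply/eqP.
  apply: (@geo_eq0 _ _ _ (eps / 2 *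
    (rnorm (a *: y1 + y2) + (rnorm (a : R[i]^o) * rnorm y1 + rnorm y2)))) => n.
  apply: le_trans (ler_rnormB _ (T n (a *: y1 + y2)) _) _.
  rewrite rnormB [T n _ in X in _ + X]linearP opprD addrACA -scalerBr.
  apply: le_trans (lerD (TfP _ n) (ler_rnormD _ _)) _; rewrite rnormZ.
  have := TfP y2 n; have := ler_wpM2l (rnorm_ge0 (a : R[i]^o)) (TfP y1 n).
  by rewrite ![eps / 2 * _ / _]mulrAC !mulrDr mulrCA; lra.
pose isL := GRing.isLinear.Build _ _ _ _ Tf Tlin.
pose Ti : {linear G -> F} := HB.pack Tf isL.
have TiE n a : rnorm (Ti a - T n a) <= eps / 2 / 2 ^+ n * rnorm a.
  by rewrite rnormB; exact: TfP.
have TiB a : rnorm (Ti a) <= 3 / 8 * eps * rnorm a.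
  (* [T 1] is bounded by [eps / 8] and the tail after it by [eps / 4], whence [3 / 8 * eps]. *)
  have := ler_rnormB (Ti a) (T 1%N a) 0; rewrite !subr0.
  have [[_ + _] _] := uP 1%N => /(_ a); have := TiE 1%N a; rewrite expr1 /T.
  by have := rnorm_ge0 a; move: (rnorm a) (rnorm _) (rnorm _) (rnorm _) => p q r s; lra.
have [|xi xiP] := @Gv_geo_complete _ _ _ v x (eps / 16).
  by move=> n; have [_ []] := uP n.
have xiP' n : rnorm (x n - xi) <= eps / 4 / 2 ^+ n.
  apply: le_trans (xiP n) _; rewrite le_eqVlt; apply/orP; left; apply/eqP.
  by field; rewrite gt_eqF// expr2_gt0.
(* Closedness is what produces the point [z] of U, from the limit of the atoms alone. *)
have /circle_atomsP[l [z [l1 xiE]]] : circle_atoms v xi.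
  apply: closed_atoms => B /nbhs_ballP[e /= ep eB].
  have er : e = (complex.Re e)%:C by rewrite RRe_real ?gtr0_real.
  have ep' : 0 < complex.Re e / 2 by rewrite divr_gt0// -ltcR -er.
  have [n nP] := half_pow_le (eps / 4) ep'.
  exists (x n); split.
    by apply/circle_atomsP; exists (u n).1.2, (u n).2; have [[]] := uP n.
  apply: eB; rewrite -ball_normE/= -rnormE er ltcR rnormB.
  by apply: le_lt_trans (xiP' n) _; move: ep' nP; lra.
exists Ti, l, z; split=> //.
  rewrite -xiE; have := xiP' 0%N; rewrite /x u0 expr0 divr1 /=; lra.
move=> g gE w.
have gw y : v y * rnorm (g y) = weighted f Ti y by rewrite gE.
have B0 : 0 <= 3 / 8 * eps by lra.
have g2 y : v y * rnorm (g y) <= 2.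
  by rewrite gw; have /andP[_] := @weighted_bounds Ti _ y B0 TiB; lra.
(* In units of [eps / 2 ^ n] the errors are 1/2 twice for the operators, 1/128 for the tolerance and
   1 for the atoms, a total below 4. *)
apply/ler_addgt0Pr => e ep; have [n nP] := half_pow_le 4 ep.
have /andP[p0 p1] := pow_le1 n.
have b0 : 0 <= eps / 2 / 2 ^+ n by rewrite !divr_ge0// ltW// expr2_gt0.
have [[/= ln1 _ near] _] := uP n.
have h1 : weighted f Ti w <= weighted f (T n) w + eps / 2 / 2 ^+ n.
  by apply: weightedD_le => // a; exact: TiE.
have h2 : weighted f (T n) (u n).2 <= weighted f Ti (u n).2 + eps / 2 / 2 ^+ n.
  by apply: weightedD_le => // a; exact: TfP.
have h3 := near w; have h4 := tolerance_le n.
have h5 : v (u n).2 * rnorm (g (u n).2) <= v z * rnorm (g z) + 2 * 2 * rnorm (x n - xi).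
  rewrite -(weight_rnorm v _ (g (u n).2) ln1) -(weight_rnorm v z (g z) l1).
  have := atom_lipschitz (u n).1.2 (u n).2 l z g2; rewrite -xiE -/(x n) => h.
  rewrite -lerBlDl; apply: le_trans h; rewrite lerBlDl.
  by set y1 := _ *: _; set y2 := _ *: _; have := ler_rnormD y2 (y1 - y2); rewrite subrKC.
have h6 := xiP' n; move: h5; rewrite !gw => h5.
have h7 : 4 / 2 ^+ n >= 4 * (eps / 2 ^+ n).
  by rewrite ler_pM2l// ler_piMl ?(ltW p0)// ltW.
have E1 (a : R) : eps / a / 2 ^+ n = eps / 2 ^+ n / a by rewrite mulrAC.
rewrite !E1 in h1 h2 h4 h6; have : 0 <= eps / 2 ^+ n by rewrite divr_ge0 ?ltW ?expr2_gt0.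
by move: h3; rewrite -/(T n); lra.
Qed.

End Iteration.

Theorem theorem1p2 (R : realType) (E : completeNormedModType R[i])
    (U : set E) (U_open : open U) (v : weight U)
    (closed_atoms : closed (circle_atoms v))
    (exposed_atoms : unif_strongly_exposed (circle_atoms v)) :
  forall F : completeNormedModType R[i], WHinf_BPB v F.
Proof.
move=> F eps eps01; have /andP[e0 e1] := eps01.
have [_ [phi [phiP expo]]] := exposed_atoms.
have kap01 n : 0 < eps / 2 ^+ (n + 4) < 1.
  have p1 : 1 <= 2 ^+ (n + 4) :> R by rewrite exprn_ege1// ler1n.
  by rewrite divr_gt0 ?expr2_gt0//= ltr_pdivrMr ?expr2_gt0// mul1r (lt_le_trans e1).
have /choice[dl dlP] n : exists d : R, 0 < d < 1 /\ forall x, circle_atoms v x ->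
    (diam (slice (phi x) d) < (eps / 2 ^+ (n + 4))%:E)%E.
  by have [d d01 dP] := expo _ (kap01 n); exists d.
have dl01 n : 0 < dl n < 1 := (dlP n).1.
have modulus n l z x : cabs l = 1 -> slice (phi (atom v l z)) (dl n) x ->
    rnorm (x - atom v l z) < eps / 2 ^+ (n + 4).
  have /andP[d0 _] := dl01 n.
  exact: exposed_atoms_modulus phiP d0 (dlP n).2 l z x.
have eta_le := tolerance_le eps01 dl01 0; rewrite expr0 divr1 in eta_le.
exists (tolerance eps dl 0).
  by rewrite tolerance_gt0//=; apply: le_lt_trans eta_le _; lra.
move=> f f1 l0 l01 z0 near0.
have cl0 : cabs l0 = 1 by apply: complexI; rewrite cabsE.
have [T [l [z [l1 TB dist0 gmax]]]] :=
  bpb_limit eps01 phiP dl01 modulus f1 cl0 near0 closed_atoms.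
pose g : Hv v F := f + MkHv (Hv_operator U_open TB).
have gE w : g w = f w + T (evaluation v w) by [].
pose M := v z * rnorm (g z).
have B0 : 0 <= 3 / 8 * eps by lra.
have gn : rnorm g = M.
  apply/le_anti; rewrite rnorm_HvE Hv_norm_ub andbT; apply: Hv_norm_le.
    by rewrite mulr_ge0 ?rnorm_ge0// ltW// weight_gt0.
  exact: gmax gE.
(* The lower bound is read at [z0], where [f] is almost norming, and passes to [z] by maximality. *)
have MB : 1 - eps / 128 - 3 / 8 * eps <= M <= 1 + 3 / 8 * eps.
  have /andP[h1 _] := weighted_bounds f1 z0 B0 TB.
  have /andP[_ h2] := weighted_bounds f1 z B0 TB.
  have h3 := gmax g gE z0; apply/andP; split; last exact: h2.
  by apply: le_trans h3; apply: le_trans h1; lra.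
have /andP[M1 M2] := MB; have M0 : 0 < M by lra.
have Mi : rnorm (M^-1%:C : R[i]^o) = M^-1.
  by have := cabs_real M^-1; rewrite gtr0_norm ?invr_gt0.
(* [g] attains its norm [M] at [z], and dividing by [M] moves it by exactly [|M - 1|]. *)
exists (M^-1%:C *: g), l, z; split.
- by rewrite /unit_sphere/= rnormZ Mi gn mulVf// gt_eqF.
- by rewrite /unit_circle/= -cabsE l1.
- have -> : (M^-1%:C *: g) z = M^-1%:C *: g z by [].
  by rewrite rnormZ Mi mulrCA mulVf// gt_eqF.
- have fg : rnorm (f - g) <= 3 / 8 * eps.
    rewrite rnorm_HvE; apply: Hv_norm_le => // w.
    have -> : (f - g) w = - T (evaluation v w).
      by rewrite -[LHS]/(f w - (f w + T (evaluation v w))) opprD addrA subrr add0r.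
    by rewrite rnormN; exact: weight_operator_le.
  have gg : rnorm (g - M^-1%:C *: g) = `|M - 1|.
    rewrite -[X in X - _]scale1r -scalerBl rnormZ gn.
    have -> : 1 - M^-1%:C = (1 - M^-1)%:C :> R[i] by rewrite rmorphB.
    have -> : rnorm ((1 - M^-1)%:C : R[i]^o) = `|1 - M^-1| by exact: cabs_real.
    by rewrite -[X in _ * X]gtr0_norm// -normrM mulrBl mul1r mulVf// gt_eqF.
  apply: le_lt_trans (ler_rnormB _ g _) _; rewrite gg.
  have : `|M - 1| <= eps / 128 + 3 / 8 * eps by rewrite ler_norml; apply/andP; split; lra.
  by lra.
- exact: dist0.
Qed.
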